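(* The EFT (Essential Flip Tree Search) algorithm is consistent under faithfulness when the data-generating distribution is faithful to a DAG whose skeleton is a tree. That is: let $\mathbb P$ be a distribution of $(X_1,\dots,X_p)$ faithful to a DAG $\mathcal H$ on $[p]$ whose skeleton is a tree, and let $\mathbb D$ be a random sample of size $n$ from $\mathbb P$. Then, in the limit as $n\to\infty$, EFT run on $\mathbb D$ returns a DAG Markov equivalent to $\mathcal H$.
   Context: $[p]=\{1,\dots,p\}$. A distribution $\mathbb P$ is Markov to a DAG $\mathcal G$ if $X_A\perp X_B\mid X_C$ whenever $A,B$ are d-separated given $C$ in $\mathcal G$; it is faithful to $\mathcal G$ if it entails exactly those conditional independence statements. Two DAGs are Markov equivalent if they have the same skeleton (underlying undirected graph) and the same v-structures (induced subgraphs $i\to j\leftarrow k$). A polytree is a DAG whose skeleton is a tree. Score: $\mathrm{BIC}(\mathcal G,\mathbb D)=\log f(\mathbb D\mid\hat\theta,\mathcal G^h)-\frac d2\log|\mathbb D|$, where $\hat\theta$ is the maximum likelihood estimate of the model parameters, $d$ the number of free parameters, and $\mathcal G^h$ the hypothesis that $\mathbb D$ is a sample from a distribution entailing the conditional independence statements encoded by $\mathcal G$. The parametric DAG models considered are such that BIC is score equivalent (equal on Markov equivalent DAGs), decomposable (a sum over nodes $i$ of local scores depending only on $i$, its parents, and the data for these variables), and consistent: in the limit of large samples, a model containing $\mathbb P$ scores strictly higher than one not containing $\mathbb P$, and among two models containing $\mathbb P$ the one with fewer parameters scores strictly higher. Mutual information: $I(X_i;X_j)=\iint f(x_i,x_j)\log\frac{f(x_i,x_j)}{f(x_i)f(x_j)}\,dx_i\,dx_j$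 (estimated from $\mathbb D$). Essential flip: for a DAG $\mathcal D$ put $c_{\mathcal D}(S)=1$ ($S\subseteq[p]$, $|S|\ge2$) if some $i\in S$ has all of $S\setminus\{i\}$ as parents, and $0$ otherwise. The essential graph of $\mathcal D$ has the same skeleton, with an edge directed $i\to j$ iff $i\to j$ in all DAGs Markov equivalent to $\mathcal D$, and undirected otherwise. For two DAGs $\mathcal G,\mathcal G'$ with the same tree skeleton $G$ let $N_i=\{S: i\in S\subseteq\mathrm{ne}_G(i)\cup\{i\},|S|\ge3\}$ (with $\mathrm{ne}_G(i)$ the neighbours of $i$), $\Delta=\{i: c_{\mathcal G}|_{N_i}\ne c_{\mathcal G'}|_{N_i}\}$, and let $\operatorname{span}(\Delta)$ be the minimal subtree of $G$ containing $\Delta$. $\{\mathcal G,\mathcal G'\}$ constitutes an essential flip if they are not Markov equivalent and, in their essential graphs, every edge of $\operatorname{span}(\Delta)$ is directed, with opposite directions in the two essential graphs. EFT algorithm (input $\mathbb D$): (1) give each edge $i-j$ of the complete graph $K_p$ the weight $-I(X_i;X_j)$ and let $G$ be a minimum weight spanning tree. (2) Let $\mathcal G$ be a random polytree with skeleton $G$ and let $M$ be the set of all subtrees of $G$. (3) Repeat: for each $s\in M$ let $\mathcal G_{\overleftarrow s}$ be $\mathcal G$ with the edges in $s$ reversed, and keep those $\mathcal G_{\overleftarrow s}$ for which $\{\mathcal G_{\overleftarrow s},\mathcal G\}$ constitutes an essential flip; let $\mathcal H'$ be a kept graph of maximal BIC. If $\mathrm{BIC}(\mathcal G,\mathbb D)\ge\mathrm{BIC}(\mathcal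 H',\mathbb D)$ (or none is kept) stop; otherwise replace $\mathcal G$ by $\mathcal H'$. (4) Return $\mathcal G$. *)

(* Defs.v *)
From HB Require Import structures.
From mathcomp Require Import all_boot all_order all_algebra.
From mathcomp Require Import all_classical all_reals all_analysis.
Import numFieldNormedType.Exports.
Import Order.TTheory GRing.Theory Num.Theory.

Set Implicit Arguments.
Unset Strict Implicit.
Unset Printing Implicit Defensive.

Local Open Scope classical_set_scope.
Local Open Scope ring_scope.

(** * Undirected graphs and trees on the vertex set ['I_p] *)

(* An undirected graph is its set of edges, an edge being a 2-element set. *)
Definition adj p (E : {set {set 'I_p}}) : rel 'I_p :=
  [rel x y | (x != y) && ([set x; y]%SET \in E)].

Definition is_tree p (E : {set {set 'I_p}}) : Prop :=
  [/\ forall e, e \in E -> #|e| = 2%N,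
      forall x y, connect (adj E) x y &
      forall s : seq 'I_p, (2 < size s)%N -> uniq s -> ~~ cycle (adj E) s].

(* A subtree of a tree is determined by its vertices: its edges are all the
   edges of the tree joining two of them. Subtrees are therefore represented by
   nonempty vertex sets inducing a connected graph; one-vertex subtrees have no
   edge. *)
Definition subtree p (E : {set {set 'I_p}}) : pred {set 'I_p} :=
  fun V => (V != finset.set0) &&
    [forall x in V, forall y in V,
       connect [rel u v | [&& adj E u v, u \in V & v \in V]] x y].

Definition is_span p (E : {set {set 'I_p}}) (Delta S : {set 'I_p}) : bool :=
  minset [pred V | subtree E V && (Delta \subset V)] S.

(** * DAGs *)

(* [(x, y) \in A] is the arc x -> y. Loops are excluded, since
   [connect _ x x] always holds. *)
Definition acyclic p (A : {set 'I_p * 'I_p}) : bool :=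
  [forall x, forall y,
     ((x, y) \in A) ==> ~~ connect [rel u v | (u, v) \in A] y x].

Record dag (p : nat) := Dag {
  arcs : {set 'I_p * 'I_p};
  arcs_acyclic : acyclic arcs }.

HB.instance Definition _ p := [isSub for @arcs p].
HB.instance Definition _ p := [Finite of dag p by <:].

Definition arc p (D : dag p) : rel 'I_p := [rel x y | (x, y) \in arcs D].

Definition parents p (D : dag p) (i : 'I_p) : {set 'I_p} :=
  [set k | arc D k i]%SET.

Definition skeleton p (D : dag p) : {set {set 'I_p}} :=
  [set [set a.1; a.2]%SET | a in arcs D]%SET.

Definition v_structure p (D : dag p) (i j k : 'I_p) : bool :=
  [&& i != k, arc D i j, arc D k j & ~~ adj (skeleton D) i k].

Definition markov_equiv p (D D' : dag p) : bool :=
  (skeleton D == skeleton D') &&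
  [forall i, forall j, forall k, v_structure D i j k == v_structure D' i j k].

(** * d-separation *)

(* The inner vertex [v] of u - v - w does not block the trail given [C]. *)
Definition unblocked p (D : dag p) (C : {set 'I_p}) (u v w : 'I_p) : bool :=
  if arc D u v && arc D w v then [exists c in C, connect (arc D) v c]
  else v \notin C.

Fixpoint active_trail p (D : dag p) (C : {set 'I_p}) (x : 'I_p)
    (s : seq 'I_p) : bool :=
  match s with
  | y :: ((z :: _) as s') => unblocked D C x y z && active_trail D C y s'
  | _ => true
  end.

Definition d_separated p (D : dag p) (A B C : {set 'I_p}) : Prop :=
  forall (a b : 'I_p) (s : seq 'I_p), a \in A -> b \in B ->
    path (adj (skeleton D)) a s -> uniq (a :: s) -> last a s = b ->
    ~~ active_trail D C a s.

(** * Essential flips *)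

Definition imset_vec p (D : dag p) (S : {set 'I_p}) : bool :=
  [exists i in S, S :\ i \subset parents D i].

Definition nbhd_sets p (E : {set {set 'I_p}}) (i : 'I_p) :
    {set {set 'I_p}} :=
  [set S : {set 'I_p} | [&& i \in S,
     S \subset i |: [set k | adj E i k] & (3 <= #|S|)%N]]%SET.

Definition flip_support p (D D' : dag p) : {set 'I_p} :=
  [set i | [exists S in nbhd_sets (skeleton D) i,
              imset_vec D S != imset_vec D' S]]%SET.

Definition essential_arc p (D : dag p) : rel 'I_p :=
  [rel i j | [forall D', markov_equiv D D' ==> arc D' i j]].

Definition essential_flip p (D D' : dag p) : Prop :=
  [/\ skeleton D = skeleton D', is_tree (skeleton D), ~~ markov_equiv D D' &
      exists2 S, is_span (skeleton D) (flip_support D D') S &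
        forall i j, i \in S -> j \in S -> adj (skeleton D) i j ->
          essential_arc D i j && essential_arc D' j i
          || essential_arc D j i && essential_arc D' i j].

(** * The EFT algorithm

   The algorithm makes arbitrary choices (a minimum weight spanning tree, a
   random initial polytree, a best candidate), so it is a relation between its
   input and its possible outputs. It sees the data only through the estimated
   mutual informations [I] and the score [sc]. *)
Section EFT.
Context (R : realType) (p : nat).
Variables (I : 'I_p -> 'I_p -> R) (sc : dag p -> R).

Definition tree_weight (E : {set {set 'I_p}}) : R :=
  \sum_(i < p) \sum_(j < p | (i < j)%N && adj E i j) - I i j.

Definition min_spanning_tree (E : {set {set 'I_p}}) : Prop :=
  is_tree E /\ forall E', is_tree E' -> tree_weight E <= tree_weight E'.

Definition reverse_in (S : {set 'I_p}) (D : dag p) : {set 'I_p * 'I_p} :=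
  [set a | if (a.1 \in S) && (a.2 \in S) then (a.2, a.1) \in arcs D
           else a \in arcs D]%SET.

(* Every orientation of a tree is acyclic, so asking the result to be a DAG
   discards nothing. *)
Definition eft_candidate (E : {set {set 'I_p}}) (D D' : dag p) : Prop :=
  exists2 S, subtree E S & arcs D' = reverse_in S D /\ essential_flip D' D.

Definition best_candidate (E : {set {set 'I_p}}) (D D' : dag p) : Prop :=
  eft_candidate E D D' /\ forall D2, eft_candidate E D D2 -> sc D2 <= sc D'.

Definition eft_step (E : {set {set 'I_p}}) (D D' : dag p) : Prop :=
  best_candidate E D D' /\ sc D < sc D'.

Definition eft_stop (E : {set {set 'I_p}}) (D : dag p) : Prop :=
  forall D', best_candidate E D D' -> sc D' <= sc D.

Inductive eft_loop (E : {set {set 'I_p}}) : dag p -> dag p -> Prop :=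
| EftStop D : eft_stop E D -> eft_loop E D D
| EftStep D D' out : eft_step E D D' -> eft_loop E D' out -> eft_loop E D out.

Definition eft_start (E : {set {set 'I_p}}) (D : dag p) : Prop :=
  min_spanning_tree E /\ skeleton D = E.

Definition eft_output (out : dag p) : Prop :=
  exists E D, eft_start E D /\ eft_loop E D out.

(* Total correctness: a run exists, all runs terminate, and whatever choices
   are made the DAG returned satisfies [Post]. *)
Definition eft_returns (Post : dag p -> Prop) : Prop :=
  [/\ exists out, eft_output out,
      forall E D, eft_start E D -> Acc (fun D2 D1 => eft_step E D1 D2) D &
      forall out, eft_output out -> Post out].
End EFT.

(** * Distributions of (X_1, ..., X_p), conditional independence *)

Definition vec (R : realType) (p : nat) := p.-tuple (measurableTypeR R).

(* The sigma-algebra generated by the X_i, i in A. *)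
Definition sigma_coord (R : realType) p (A : {set 'I_p}) : set (set (vec R p)) :=
  <<s [set E | exists2 i, i \in A &
         exists2 B : set (measurableTypeR R), measurable B &
           E = (fun x : vec R p => tnth x i) @^-1` B] >>.

(* [g] is a version of P(E | X_C). *)
Definition is_cond_prob (R : realType) p (P : probability (vec R p) R)
    (C : {set 'I_p}) (E : set (vec R p)) (g : vec R p -> R) : Prop :=
  [/\ forall B : set (measurableTypeR R), measurable B -> sigma_coord C (g @^-1` B),
      P.-integrable setT (EFin \o g) &
      forall D, sigma_coord C D ->
        (\int[P]_(x in D) (g x)%:E = P (E `&` D))%E].

Definition cond_indep (R : realType) p (P : probability (vec R p) R)
    (A B C : {set 'I_p}) : Prop :=
  forall E F, sigma_coord A E -> sigma_coord B F ->
    exists g h : vec R p -> R,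
      [/\ is_cond_prob P C E g, is_cond_prob P C F h &
          is_cond_prob P C (E `&` F) (fun x => g x * h x)].

Definition disjoint3 p (A B C : {set 'I_p}) : bool :=
  [&& [disjoint A & B], [disjoint A & C] & [disjoint B & C]].

Definition markov (R : realType) p (P : probability (vec R p) R) (D : dag p) :
    Prop :=
  forall A B C, disjoint3 A B C -> d_separated D A B C -> cond_indep P A B C.

Definition faithful (R : realType) p (P : probability (vec R p) R)
    (D : dag p) : Prop :=
  forall A B C, disjoint3 A B C -> (cond_indep P A B C <-> d_separated D A B C).

(** * Densities and mutual information

   Densities are taken with respect to sigma-finite reference measures [mu i]
   on the line: Lebesgue measure for a continuous X_i, a counting measure for
   a discrete one. *)

Definition is_density (R : realType) (d : measure_display) (T : measurableType d)
    (m : {measure set T -> \bar R}) (law : set T -> \bar R) (f : T -> R) : Prop :=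
  [/\ measurable_fun setT f, forall x, 0 <= f x &
      forall A, measurable A -> (law A = \int[m]_(x in A) (f x)%:E)%E].

Definition line_measures (R : realType) (p : nat) :=
  'I_p -> {sigma_finite_measure set (measurableTypeR R) -> \bar R}.

(* This determines [nu], the factors being sigma-finite. *)
Definition is_product_measure (R : realType) p (mu : line_measures R p)
    (nu : {measure set (vec R p) -> \bar R}) : Prop :=
  forall A : 'I_p -> set (measurableTypeR R), (forall i, measurable (A i)) ->
    (nu [set x | forall i, A i (tnth x i)] = \prod_(i < p) mu i (A i))%E.

(* The (finite) mutual information of X_i and X_j is [v]; since [ln 0 = 0] and
   [x / 0 = 0], the integrand vanishes where [fij] does. *)
Definition is_mutual_info (R : realType) p (mu : line_measures R p)
    (P : probability (vec R p) R) (i j : 'I_p) (v : R) : Prop :=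
  exists (fi fj : measurableTypeR R -> R)
         (fij : measurableTypeR R * measurableTypeR R -> R),
    let integrand z := (fij z * ln (fij z / (fi z.1 * fj z.2)))%:E in
    [/\ is_density (mu i) (pushforward P (fun x : vec R p => tnth x i)) fi,
        is_density (mu j) (pushforward P (fun x : vec R p => tnth x j)) fj,
        is_density (mu i \x mu j)%E
          (pushforward P (fun x : vec R p => (tnth x i, tnth x j))) fij,
        (mu i \x mu j)%E.-integrable setT integrand &
        (\int[mu i \x mu j]_z integrand z = v%:E)%E].

(** * Random samples and the large sample limit *)

(* "With probability tending to one". The event may fail to be measurable (it
   may involve suprema over parameters), hence the measurable [A n]. *)
Definition whp (R : realType) (d : measure_display) (Omega : measurableType d)
    (Q : probability Omega R) (E : nat -> set Omega) : Prop :=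
  exists A : nat -> set Omega,
    (forall n, measurable (A n) /\ A n `<=` E n) /\
    (Q (A n) @[n --> \oo] --> 1%E).

Definition iid_sample (R : realType) p (P : probability (vec R p) R)
    (d : measure_display) (Omega : measurableType d) (Q : probability Omega R)
    (X : nat -> Omega -> vec R p) : Prop :=
  [/\ forall k, measurable_fun setT (X k),
      forall k A, measurable A -> Q (X k @^-1` A) = P A &
      forall n (A : nat -> set (vec R p)), (forall k, measurable (A k)) ->
        (Q (\bigcap_(k < n) X k @^-1` A k) = \prod_(k < n) Q (X k @^-1` A k))%E].

Definition data (R : realType) (p n : nat) := n.-tuple (vec R p).

Definition sample_data (R : realType) p (Omega : Type)
    (X : nat -> Omega -> vec R p) (n : nat) (w : Omega) : data R p n :=
  [tuple X k w | k < n].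

(** * Parametric DAG models and their BIC *)

(* [nparam G] is the number of free parameters of the model of [G], [params G]
   its parameter space and [dens G theta] the density f(. | theta, G). *)
Record dag_model (R : realType) (p : nat) := DagModel {
  nparam : dag p -> nat;
  params : forall G : dag p, set 'rV[R]_(nparam G);
  dens : forall G : dag p, 'rV[R]_(nparam G) -> vec R p -> R }.

Arguments params {R p} _ _ _.
Arguments dens {R p} _ _ _ _.

Definition contains (R : realType) p (M : dag_model R p)
    (nu : {measure set (vec R p) -> \bar R}) (G : dag p)
    (P : probability (vec R p) R) : Prop :=
  exists2 theta, params M G theta & is_density nu P (dens M G theta).

Definition in_family (R : realType) p (M : dag_model R p)
    (nu : {measure set (vec R p) -> \bar R}) (P : probability (vec R p) R) :
    Prop :=
  exists G, contains M nu G P.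

(* Each parameter defines a distribution, and the model of [G] consists of the
   distributions of the parametric family that entail the conditional
   independence statements encoded by [G]. *)
Definition parametric_dag_model (R : realType) p (M : dag_model R p)
    (nu : {measure set (vec R p) -> \bar R}) : Prop :=
  (forall G theta, params M G theta ->
     exists P : probability (vec R p) R, is_density nu P (dens M G theta)) /\
  (forall G P, contains M nu G P <-> in_family M nu P /\ markov P G).

Section BIC.
Context (R : realType) (p : nat) (M : dag_model R p).

Definition likelihood (G : dag p) n (D : data R p n)
    (theta : 'rV[R]_(nparam M G)) : R :=
  \prod_(k < n) dens M G theta (tnth D k).

(* Positivity of the likelihood makes its logarithm meaningful. *)
Definition is_mle (G : dag p) n (D : data R p n)
    (theta : 'rV[R]_(nparam M G)) : Prop :=
  [/\ params M G theta, 0 < likelihood D theta &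
      forall theta', params M G theta' -> likelihood D theta' <= likelihood D theta].

(* The score of every DAG is defined on the data. *)
Definition has_mles n (D : data R p n) : Prop :=
  forall G, exists theta, @is_mle G n D theta.

Definition mle (G : dag p) n (D : data R p n) : 'rV[R]_(nparam M G) :=
  xget 0 [set theta | is_mle D theta].

(* Meaningful when [has_mles D]; the value does not depend on which maximizer
   [mle] selects. *)
Definition bic n (D : data R p n) (G : dag p) : R :=
  ln (likelihood D (mle G D)) - (nparam M G)%:R / 2 * ln n%:R.

Definition score_equivalent : Prop :=
  forall n (D : data R p n), has_mles D ->
    forall G G', markov_equiv G G' -> bic D G = bic D G'.

Definition decomposable : Prop :=
  exists s : forall n, data R p n -> 'I_p -> {set 'I_p} -> R,
    (forall n (D D' : data R p n) i Pa,
       (forall k l, l \in i |: Pa -> tnth (tnth D k) l = tnth (tnth D' k) l) ->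
       s n D i Pa = s n D' i Pa) /\
    (forall n (D : data R p n), has_mles D ->
       forall G, bic D G = \sum_(i < p) s n D i (parents G i)).

Variable nu : {measure set (vec R p) -> \bar R}.

Definition mles_eventually_exist : Prop :=
  forall P : probability (vec R p) R, in_family M nu P ->
  forall (d : measure_display) (Omega : measurableType d)
    (Q : probability Omega R) (X : nat -> Omega -> vec R p),
  iid_sample P Q X ->
  whp Q (fun n => [set w | has_mles (sample_data X n w)]).

Definition bic_consistent : Prop :=
  forall (P : probability (vec R p) R)
    (d : measure_display) (Omega : measurableType d)
    (Q : probability Omega R) (X : nat -> Omega -> vec R p),
  iid_sample P Q X ->
  forall G G' : dag p, contains M nu G P ->
    ~ contains M nu G' P \/ contains M nu G' P /\ (nparam M G < nparam M G')%N ->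
    whp Q (fun n => [set w |
      bic (sample_data X n w) G' < bic (sample_data X n w) G]).

(* The estimates of the mutual informations used by the algorithm converge in
   probability to the true values, for the distributions of the family. *)
Definition mi_consistent (mu : line_measures R p)
    (Ihat : forall n, data R p n -> 'I_p -> 'I_p -> R) : Prop :=
  forall P : probability (vec R p) R, in_family M nu P ->
  forall (d : measure_display) (Omega : measurableType d)
    (Q : probability Omega R) (X : nat -> Omega -> vec R p),
  iid_sample P Q X ->
  forall i j v, i != j -> is_mutual_info mu P i j v ->
  forall eps : R, 0 < eps ->
    whp Q (fun n => [set w | `|Ihat n (sample_data X n w) i j - v| < eps]).
End BIC.

(* Main.v *)
(** Strict data processing: if X_i and X_j are independent given X_k, but X_k and
    X_j are not independent given X_i, then I(X_i;X_j) < I(X_k;X_j). Under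
    faithfulness this makes every edge of the skeleton T of H on the path from i
    to j carry more information than a non-adjacent pair i, j, so, by exchanging
    edges, T is the only maximum weight spanning tree for estimates close enough
    to the true values.

    On the DAGs with skeleton T the score is then maximal exactly at the DAGs
    equivalent to H, the only ones containing P, and the search has no other
    local maximum. Given D and a better A, glue pieces of D and A (or of
    equivalent DAGs) along an edge on which they agree: the two DAGs obtained
    have together the parent sets of the two glued ones, so the changes of score
    add up and one of the two is still better than D. This brings A closer to D
    until A is obtained from D by an essential flip. *)

Require Import Defs.
From HB Require Import structures.
From mathcomp Require Import all_boot all_order all_algebra.
From mathcomp Require Import all_classical all_reals all_analysis.
From mathcomp Require Import unstable measurable_realfun.
From mathcomp Require Import ring lra zify.
(* Otherwise [arc] denotes [path.arc]. *)
Import Defs.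
Import numFieldNormedType.Exports.
Import Order.TTheory GRing.Theory Num.Theory.
Local Open Scope classical_set_scope.
Local Open Scope ring_scope.

Set Implicit Arguments.
Unset Strict Implicit.
Unset Printing Implicit Defensive.

(** * Densities *)

(** Only pairs of variables come with densities, so data processing cannot rest on a density of
    (X_i, X_k, X_j). The law of ((X_i, X_k), X_j) is compared instead with the product of the law of
    (X_i, X_k) and the reference measure of X_j. There the conditional densities of X_j given X_k
    and given X_i are two candidate densities, the mean logarithm of their ratio is I(X_k;X_j) -
    I(X_i;X_j), and if this is not positive, the equality case of Gibbs' inequality makes both of
    them densities.

    In the search a candidate has to meet two conditions: it reverses the edges of one subtree, and
    it is an essential flip. Gluing secures one at a time, and working on the second may spoil the
    first. Termination therefore rests on a lexicographic pair: the number of vertices whose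
    colliders differ, then the number of arcs that differ. The first number is invariant under
    Markov equivalence, which is what allows DAGs to be replaced by equivalent ones before
    gluing. *)

Section density.
Local Open Scope ereal_scope.
Context d (T : measurableType d) (R : realType).
Variables (m law : {measure set T -> \bar R}) (f : T -> R).
Hypothesis df : is_density m law f.

Import HBNNSimple.

Let mf : measurable_fun setT f. Proof. by case: df. Qed.
Let f0 x : (0 <= f x)%R. Proof. by case: df. Qed.

Let integral_indicM B (mB : measurable B) :
  \int[m]_x ((\1_B x)%:E * (f x)%:E) = law B.
Proof.
case: df => _ _ ->//; rewrite [RHS]integral_mkcond; apply: eq_integral => x _.
by rewrite patchE indicE; case: ifPn => _; rewrite ?mul1e ?mul0e.
Qed.

Lemma density_ge0_integral (g : T -> \bar R) :
  measurable_fun setT g -> (forall x, 0 <= g x) ->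
  \int[law]_x g x = \int[m]_x (g x * (f x)%:E).
Proof.
move=> mg g0; pose h := nnsfun_approx measurableT mg.
have mfE : measurable_fun setT (EFin \o f) by exact/measurable_EFinP.
have gE x : g x = limn (fun n => (h n x)%:E).
  by apply/esym/cvg_lim => //; apply: cvg_nnsfun_approx.
have gfE x : g x * (f x)%:E = limn (fun n => (h n x)%:E * (f x)%:E).
  apply/esym/cvg_lim => //; apply: cvgeZr => //.
  exact: cvg_nnsfun_approx.
under eq_integral do rewrite gE.
under [RHS]eq_integral do rewrite gfE.
rewrite monotone_convergence//; last 3 first.
  by move=> n; apply/measurable_EFinP/measurable_funP.
  by move=> n x _; rewrite lee_fin.
  by move=> x _ a b ab; rewrite lee_fin; exact/lefP/nd_nnsfun_approx.
rewrite monotone_convergence//; last 3 first.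
  by move=> k; apply: (@emeasurable_funM _ _ _ _ (EFin \o h k)) => //;
    apply/measurable_EFinP/measurable_funP.
  by move=> n x _; rewrite mule_ge0// lee_fin.
  by move=> x _ a b ab; rewrite lee_wpmul2r ?lee_fin//; exact/lefP/nd_nnsfun_approx.
congr (limn _); apply/funext => n.
transitivity (\int[law]_x (\sum_(y \in range (h n))
   (y * \1_(h n @^-1` [set y]) x)%:E)).
  by apply: eq_integral => t _; rewrite /= fimfunE -fsumEFin.
transitivity (\int[m]_x (\sum_(y \in range (h n))
    (y * \1_(h n @^-1` [set y]) x)%:E * (f x)%:E)); last first.
  apply: eq_integral => x _.
  by rewrite -ge0_mule_fsuml ?fsumEFin -?fimfunE// => y; exact: nnfun_muleindic_ge0.
have mi y : measurable_fun setT (fun x => (y * \1_(h n @^-1` [set y]) x)%:E).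
  by apply/measurable_EFinP/measurable_funM.
rewrite !ge0_integral_fsum//; last first.
- by move=> y x _; exact: nnfun_muleindic_ge0.
- by move=> y x _; rewrite mule_ge0 ?lee_fin//; exact: nnfun_muleindic_ge0.
- by move=> y; apply: (emeasurable_funM (mi y)); exact: mfE.
apply: eq_fsbigr => r rhn.
have r0 : (0 <= r)%R by move: rhn; rewrite inE => -[t _ <-].
under eq_integral do rewrite EFinM.
under [RHS]eq_integral do rewrite EFinM -muleA.
rewrite !ge0_integralZl_EFin//.
- by rewrite integral_indicM// integral_indic// setIT.
- by move=> x _; rewrite mule_ge0// lee_fin.
- by apply: emeasurable_funM => //; exact/measurable_EFinP.
- exact/measurable_EFinP.
Qed.

Lemma density_integral (g : T -> R) : measurable_fun setT g ->
  m.-integrable setT (fun x => (g x * f x)%:E) ->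
  law.-integrable setT (EFin \o g) /\
  \int[law]_x (g x)%:E = \int[m]_x (g x * f x)%:E.
Proof.
move=> mg ig.
have mgE : measurable_fun setT (EFin \o g) by exact/measurable_EFinP.
split.
  apply/integrableP; split => //.
  rewrite density_ge0_integral//=; last by apply/measurable_EFinP;
    exact: measurableT_comp.
  case/integrableP : ig => _; apply: le_lt_trans.
  rewrite le_eqVlt; apply/orP; left; apply/eqP; apply: eq_integral => x _.
  by rewrite /= normrM (ger0_norm (f0 x)).
rewrite integralE [RHS]integralE.
rewrite !density_ge0_integral//=;
  [|exact: measurable_funeneg|exact: measurable_funepos].
by congr (_ - _); apply: eq_integral => x _;
  rewrite ?funeposE ?funenegE /= -?EFinN -?EFin_max -EFinM ?maxr_pMl ?mul0r ?mulNr.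
Qed.

(** The law gives no mass to the zero set of [f]. Logarithms of densities are thus genuine almost
    surely, in spite of the convention [ln 0 = 0]. *)
Lemma density_ae_gt0 : {ae law, forall x, (0 < f x)%R}.
Proof.
have mZ : measurable [set x | f x = 0%R].
  by rewrite -[X in measurable X]setTI; exact: (mf measurableT (measurable_set1 0%R)).
exists [set x | f x = 0%R]; split => //.
- by case: df => _ _ ->//; apply: integral0_eq => x /= ->.
- move=> x /=; rewrite lt_def f0 andbT => /negP; rewrite negbK => /eqP; exact.
Qed.

End density.

Lemma measurable_fun_div_ge0 d (T : measurableType d) (R : realType)
    (f g : T -> R) : measurable_fun setT f -> measurable_fun setT g ->
  (forall x, 0 <= g x) -> measurable_fun setT (fun x => f x / g x).
Proof.
move=> mf mg g0; apply: measurable_funM => //.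
(* On nonnegative reals the inverse is the power -1, also at 0, where both are 0. *)
rewrite (_ : (fun x => _) = (fun x => powR x (-1)) \o g).
  by apply: measurableT_comp => //; exact: measurable_powR.
by apply/funext => x /=; rewrite powR_inv1.
Qed.

Lemma integral_mul_indic d (T : measurableType d) (R : realType)
    (m : {measure set T -> \bar R}) (A : set T) (f : T -> R) :
  measurable A ->
  (\int[m]_(x in A) (f x)%:E = \int[m]_x (f x * \1_A x)%:E)%E.
Proof.
move=> mA; rewrite integral_mkcond; apply: eq_integral => x _.
by rewrite patchE indicE; case: ifPn => _; rewrite ?mulr1 ?mulr0.
Qed.

Lemma measurable_rectangle_unique d1 d2 (T1 : measurableType d1)
    (T2 : measurableType d2) (R : realType)
    (L1 L2 : {measure set (T1 * T2) -> \bar R}) :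
  (L1 setT < +oo)%E ->
  (forall A B, measurable A -> measurable B -> L1 (A `*` B) = L2 (A `*` B)) ->
  forall S, measurable S -> L1 S = L2 S.
Proof.
move=> L1oo L12 S mS.
apply: (measure_unique [set A `*` B | A in measurable & B in measurable]
  (fun=> setT)) => //.
- exact: measurable_prod_measurableType.
- move=> _ _ [A mA [B mB <-]] [A' mA' [B' mB' <-]].
  exists (A `&` A'); first exact: measurableI.
  by exists (B `&` B'); [exact: measurableI|rewrite setXI].
- by move=> _; exists setT => //; exists setT => //; rewrite setXTT.
- by rewrite bigcup_const//; exists 0%N.
- by move=> _ [A mA [B mB <-]]; exact: L12.
Qed.

(** Fixing the last side [C] reduces boxes to rectangles: each measure is restricted to the cylinder
    over [C] and pushed forward to [T1 * T2]. *)
Lemma measurable_box_unique d1 d2 d3 (T1 : measurableType d1)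
    (T2 : measurableType d2) (T3 : measurableType d3) (R : realType)
    (L1 L2 : {measure set (T1 * T2 * T3) -> \bar R}) :
  (L1 setT < +oo)%E ->
  (forall A B C, measurable A -> measurable B -> measurable C ->
     L1 (A `*` B `*` C) = L2 (A `*` B `*` C)) ->
  forall S, measurable S -> L1 S = L2 S.
Proof.
move=> L1oo L12; apply: measurable_rectangle_unique => // A C mA mC.
have mTC : measurable ([set: T1 * T2] `*` C) by exact: measurableX.
have mfst : measurable_fun setT (@fst (T1 * T2) T3) by [].
have LE (L : {measure set (T1 * T2 * T3) -> \bar R}) B :
    pushforward (mrestr L mTC) fst B = L (B `*` C).
  rewrite /pushforward /mrestr; congr (L _).
  by apply/seteqP; split => [[x y] [/= ? [_ ?]]|[x y] [/= ? ?]].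
rewrite -!LE.
apply: (@measurable_rectangle_unique _ _ _ _ _
  (pushforward (mrestr L1 mTC) fst) (pushforward (mrestr L2 mTC) fst)) => //.
- apply: le_lt_trans L1oo; apply: (@le_trans _ _ (L1 ([set: T1 * T2] `*` C))).
    by rewrite le_eqVlt; apply/orP; left; apply/eqP; exact: LE.
  by apply: le_measure; rewrite ?inE.
- move=> A' B' mA' mB'.
  exact: (etrans (LE L1 _) (etrans (L12 _ _ _ mA' mB' mC) (esym (LE L2 _)))).
Qed.

Section density_measure.
Local Open Scope ereal_scope.
Context d (T : measurableType d) (R : realType).
Variables (m : {measure set T -> \bar R}) (f : T -> R).
Hypotheses (mf : measurable_fun setT f) (f0 : forall x, (0 <= f x)%R).

(** The proofs of measurability and nonnegativity are arguments so that the measure structure below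
    can be attached to the function itself. *)
Definition density_measure of measurable_fun setT f & (forall x, (0 <= f x)%R) :=
  fun A => \int[m]_(x in A) (f x)%:E.

Local Notation mu := (density_measure mf f0).

Let mu0 : mu set0 = 0. Proof. exact: integral_set0. Qed.

Let mu_ge0 A : 0 <= mu A.
Proof. by apply: integral_ge0 => x _; rewrite lee_fin. Qed.

Let mu_sigma_additive : semi_sigma_additive mu.
Proof.
move=> F mF tF mUF; rewrite /density_measure ge0_integral_bigcup//.
- by apply: is_cvg_ereal_nneg_natsum => n _; exact: mu_ge0.
- by apply/measurable_EFinP/measurable_funTS.
- by move=> x _; rewrite lee_fin.
Qed.

HB.instance Definition _ := isMeasure.Build _ _ _ mu
  mu0 mu_ge0 mu_sigma_additive.

End density_measure.

(** * Gibbs' inequality and its equality case *)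

Lemma ln_leB1 (R : realType) (t : R) : 0 < t -> ln t <= t - 1.
Proof.
move=> t0; rewrite -[X in ln X](subrKC 1) le_ln1Dx//.
by rewrite ltrBrDl subrr.
Qed.

Lemma ln_eqB1 (R : realType) (t : R) : 0 < t -> ln t = t - 1 -> t = 1.
Proof.
move=> t0 lnt; apply/eqP/negPn/negP => t1.
have := @expR_gt1Dx R (t - 1); rewrite subr_eq0 => /(_ t1).
by rewrite -lnt lnK ?posrE// lnt subrKC ltxx.
Qed.

Section gibbs.
Local Open Scope ereal_scope.
Context d (T : measurableType d) (R : realType) (P : probability T R).
Context d1 (W : measurableType d1) (U : {mfun T >-> W}).

Lemma ae_distribution (A : set W) :
  {ae distribution P U, forall x, A x} -> {ae P, forall w, A (U w)}.
Proof.
move=> [N [mN N0 AN]]; exists (U @^-1` N); split => //.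
- by rewrite -[X in measurable X]setTI; exact: measurable_funPT.
- by move=> w /= nA; exact: AN.
Qed.

Lemma rv_density_ge0_integral (m : {measure set W -> \bar R}) (f : W -> R)
    (g : W -> \bar R) : is_density m (pushforward P U) f ->
  measurable_fun setT g -> (forall x, 0 <= g x) ->
  \int[P]_w g (U w) = \int[m]_x (g x * (f x)%:E).
Proof.
move=> df mg g0; rewrite -(@density_ge0_integral _ _ _ m (distribution P U))//.
by rewrite ge0_integral_distribution.
Qed.

Lemma rv_density_ae_gt0 (m : {measure set W -> \bar R}) (f : W -> R) :
  is_density m (pushforward P U) f -> {ae P, forall w, (0 < f (U w))%R}.
Proof.
move=> df; apply: (@ae_distribution [set x | (0 < f x)%R]).
exact: (@density_ae_gt0 _ _ _ m).
Qed.

Variables (n : {measure set W -> \bar R}) (a b : W -> R).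
Hypotheses (da : is_density n (pushforward P U) a)
  (mb : measurable_fun setT b) (b0 : forall x, (0 <= b x)%R)
  (b1 : \int[n]_x (b x)%:E <= 1)
  (b_gt0 : {ae P, forall w, (0 < b (U w))%R})
  (iab : P.-integrable setT (fun w => (ln (a (U w) / b (U w)))%:E))
  (ab_le0 : \int[P]_w (ln (a (U w) / b (U w)))%:E <= 0).

Let ma : measurable_fun setT a. Proof. by case: da. Qed.
Let a0 x : (0 <= a x)%R. Proof. by case: da. Qed.
Let r w := (b (U w) / a (U w))%R.

Let mba : measurable_fun setT (fun x => (b x / a x)%R).
Proof. exact: measurable_fun_div_ge0. Qed.

Let mr : measurable_fun setT r.
Proof. exact: (measurableT_comp mba). Qed.

Let r0 w : (0 <= r w)%R. Proof. exact: divr_ge0. Qed.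

Let integral_ratio_le1 : \int[P]_w (r w)%:E <= 1.
Proof.
rewrite (rv_density_ge0_integral (g := fun x => (b x / a x)%:E) da)//.
- apply: le_trans b1; apply: ge0_le_integral => //.
  + by move=> x _; rewrite lee_fin mulr_ge0// divr_ge0.
  + by apply: emeasurable_funM; exact/measurable_EFinP.
  + exact/measurable_EFinP.
  + move=> x _; rewrite -EFinM lee_fin.
    (* Where [a] vanishes the ratio is 0 by convention, so only an inequality holds. *)
    have [->|ax0] := eqVneq (a x) 0%R; first by rewrite mulr0.
    by rewrite divfK.
- exact/measurable_EFinP.
- by move=> x; rewrite lee_fin divr_ge0.
Qed.

Let ir : P.-integrable setT (EFin \o r).
Proof.
apply/integrableP; split; first exact/measurable_EFinP.
under eq_integral do rewrite /= ger0_norm//.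
by apply: le_lt_trans integral_ratio_le1 _; rewrite ltry.
Qed.

(** Adding [r - 1], of integral at most 0, turns the log ratio into [r - 1 - ln r], which is
    nonnegative and vanishes only at [r = 1]. *)
Let gap w := (ln (a (U w) / b (U w)) + (r w - 1))%R.

Let ln_gapE w : (0 < a (U w))%R -> (0 < b (U w))%R ->
  gap w = (r w - 1 - ln (r w))%R.
Proof.
by move=> aw bw; rewrite /gap -[(a _ / _)%R]invf_div lnV ?posrE ?divr_gt0// addrC.
Qed.

Let mgap : measurable_fun setT (EFin \o gap).
Proof.
apply/measurable_EFinP/measurable_funD.
  by apply/measurable_EFinP; exact: measurable_int iab.
exact: measurable_funB.
Qed.

Let gap_ge0 : {ae P, forall w, (0 <= gap w)%R}.
Proof.
have aU := rv_density_ae_gt0 da.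
near=> w; have aw : (0 < a (U w))%R by near: w.
have bw : (0 < b (U w))%R by near: w.
by rewrite ln_gapE// subr_ge0 ln_leB1// divr_gt0.
Unshelve. all: by end_near. Qed.

Let ratio1 : {ae P, forall w, a (U w) = b (U w)}.
Proof.
have aU := rv_density_ae_gt0 da.
have igap : \int[P]_w (gap w)%:E <= 0.
  have icst : P.-integrable setT (fun=> (- 1%R)%:E).
    exact: (finite_measure_integrable_cst P (- 1)%R).
  have ir1 : P.-integrable setT (fun w => (r w)%:E + (- 1%R)%:E)
    by exact: integrableD.
  rewrite /gap; under eq_integral do rewrite !EFinD.
  have icE : \int[P]_w (- 1%R)%:E = - 1%:E.
    by rewrite integral_cst// -[RHS]mule1; congr (_ * _); exact: probability_setT.
  rewrite integralD//= integralD//= icE.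
  by rewrite -[leRHS]adde0 leeD// sube_le0.
have igap0 : \int[P]_w `|(gap w)%:E| = 0.
  apply/eqP; rewrite eq_le integral_ge0// andbT (le_trans _ igap)//.
  rewrite le_eqVlt; apply/orP; left; apply/eqP.
  apply: ae_eq_integral => //; first exact: measurableT_comp.
  by apply: filterS gap_ge0 => w gw _; rewrite gee0_abs.
move/ae_eq_integral_abs : igap0 => /(_ measurableT mgap) gap0.
near=> w; have aw : (0 < a (U w))%R by near: w.
have bw : (0 < b (U w))%R by near: w.
have : (EFin \o gap) w = 0 by near: w; apply: filterS gap0 => w; exact.
move=> [] /eqP; rewrite ln_gapE// subr_eq0 => /eqP/esym /ln_eqB1.
rewrite divr_gt0// => /(_ isT) /eqP; rewrite /r -[1%R](divff (lt0r_neq0 aw)).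
by move=> /eqP/(mulIf (invr_neq0 (lt0r_neq0 aw))).
Unshelve. all: by end_near. Qed.

(** It is enough that [b] has mass at most 1: almost sure equality of [a] and [b] makes the integral
    of [b] dominate the law on every set, and there is no mass left for a strict inequality. *)
Lemma gibbs_density : is_density n (pushforward P U) b.
Proof.
split => // S mS; pose law : probability W R := distribution P U.
have lawT : law setT = 1 by exact: probability_setT.
have mD : measurable [set x | a x = b x].
  rewrite (_ : [set x | _] = (fun x => a x - b x)%R @^-1` [set 0%R]).
    rewrite -[X in measurable X]setTI.
    exact: (measurable_funB ma mb measurableT (measurable_set1 0%R)).
  apply/seteqP; split => x /= => [->|/eqP]; first by rewrite subrr.
  by rewrite subr_eq0 => /eqP.
have lawD : law (~` [set x | a x = b x]) = 0.
  have mU : measurable_fun setT U by exact: measurable_funPT.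
  case: ratio1 => N [mN N0 abN].
  apply: (subset_measure0 (mu := P) _ mN abN N0).
  by rewrite -[X in measurable X]setTI; exact: (mU measurableT _ (measurableC mD)).
(* Restricting to the set where [a] and [b] agree loses no mass of the law, but may lose mass of
   [b]. *)
have law_le S' : measurable S' -> law S' <= \int[n]_(x in S') (b x)%:E.
  move=> mS'; rewrite (measureDI law mS' mD) [X in X + _](_ : _ = 0) ?add0e;
    last first.
    apply: (subset_measure0 _ _ _ lawD); [exact: measurableD|exact: measurableC|].
    by move=> x [].
  apply: (@le_trans _ _ (\int[n]_(x in S' `&` [set x | a x = b x]) (b x)%:E)).
    case: da => _ _ daE; rewrite le_eqVlt; apply/orP; left; apply/eqP.
    rewrite [LHS]daE; last exact: measurableI.
    by apply: eq_integral => x /[!inE] -[_ /= ->].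
  apply: ge0_subset_integral => //; first exact: measurableI.
  - by apply/measurable_EFinP/measurable_funTS.
  - by move=> x _; rewrite lee_fin.
apply/eqP; rewrite eq_le law_le//=.
(* The reverse inequality comes from [law_le] on the complement, the two integrals of [b] adding up
   to at most 1. *)
have mSC : measurable (~` S) by exact: measurableC.
have ST : S `|` ~` S = setT by exact: setUv.
have bE : \int[n]_(x in S) (b x)%:E + \int[n]_(x in ~` S) (b x)%:E <= 1.
  rewrite -ge0_integral_setU ?ST//.
  - exact/measurable_EFinP.
  - by move=> x _; rewrite lee_fin.
  - by apply/disj_setPCl.
have bfin : \int[n]_(x in ~` S) (b x)%:E \is a fin_num.
  rewrite ge0_fin_numE ?integral_ge0//; last by move=> x _; rewrite lee_fin.
  apply: (@le_lt_trans _ _ 1); last by rewrite ltry.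
  by apply: le_trans bE; rewrite leeDr// integral_ge0// => x _; rewrite lee_fin.
rewrite -(leeD2rE _ _ bfin) (le_trans bE)// -lawT -ST measureU//.
- by rewrite leeD2l// law_le.
- by rewrite setICr.
Qed.
End gibbs.

(** * Conditional densities *)

Section rv_pair.
Context d d1 d2 (T : measurableType d) (T1 : measurableType d1)
  (T2 : measurableType d2) (X : {mfun T >-> T1}) (Y : {mfun T >-> T2}).

Definition rv_pair (w : T) : T1 * T2 := (X w, Y w).

Let measurable_rv_pair : measurable_fun setT rv_pair.
Proof. by apply: measurable_fun_pair; exact: measurable_funPT. Qed.

HB.instance Definition _ := isMeasurableFun.Build _ _ _ _ rv_pair measurable_rv_pair.

End rv_pair.

(** The conditional distribution of Y given X = x. The default values of [fine] and of the division
    occur only where the slice has infinite integral or [f1] vanishes, a set not charged by the law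
    of X. *)
Definition dkernel d1 d2 (T1 : measurableType d1) (T2 : measurableType d2)
    (R : realType) (m2 : {measure set T2 -> \bar R}) (f : T1 * T2 -> R)
    (f1 : T1 -> R) (x : T1) (B : set T2) : R :=
  fine (\int[m2]_(y in B) (f (x, y))%:E) / f1 x.

Section conditional_density.
Local Open Scope ereal_scope.
Context d (T : measurableType d) (R : realType) (P : probability T R).
Context d1 d2 (T1 : measurableType d1) (T2 : measurableType d2).
Variables (X : {mfun T >-> T1}) (Y : {mfun T >-> T2}).
Variables (m1 : {sigma_finite_measure set T1 -> \bar R})
  (m2 : {sigma_finite_measure set T2 -> \bar R}).
Variables (f1 : T1 -> R) (f : T1 * T2 -> R).
Hypotheses (df1 : is_density m1 (pushforward P X) f1)
  (df : is_density (m1 \x m2) (pushforward P (rv_pair X Y)) f).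

Local Notation K := (dkernel m2 f f1).

Let mf1 : measurable_fun setT f1. Proof. by case: df1. Qed.
Let f10 x : (0 <= f1 x)%R. Proof. by case: df1. Qed.
Let mf : measurable_fun setT f. Proof. by case: df. Qed.
Let f0 x : (0 <= f x)%R. Proof. by case: df. Qed.
Let mfx x : measurable_fun setT (fun y => f (x, y)).
Proof. exact: measurableT_comp. Qed.
Let mfxE x : measurable_fun setT (fun y => (f (x, y))%:E).
Proof. exact/measurable_EFinP. Qed.
Lemma dkernel_ge0 x B : (0 <= K x B)%R.
Proof.
apply: divr_ge0 => //; apply: fine_ge0; apply: integral_ge0 => y _.
by rewrite lee_fin.
Qed.

Let measurable_slice B : measurable B ->
  measurable_fun setT (fun x => \int[m2]_(y in B) (f (x, y))%:E).
Proof.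
move=> mB; under eq_fun do rewrite integral_mul_indic//.
apply: (measurable_fun_fubini_tonelli_F (fun z => (f z * \1_B z.2)%:E)) => //.
  apply/measurable_EFinP/measurable_funM => //.
  by apply: measurableT_comp => //; exact: measurable_indic.
by move=> z; rewrite lee_fin mulr_ge0.
Qed.

Lemma measurable_dkernel B : measurable B -> measurable_fun setT (K ^~ B).
Proof.
move=> mB; apply: measurable_fun_div_ge0 => //.
by apply: (@measurableT_comp _ _ _ _ _ _ (@fine R)) => //; exact: measurable_slice.
Qed.

(** The densities [f1] and [f] are chosen separately, so [f1] is the marginal of [f] only almost
    everywhere: over any set both integrate to the law of X. *)
Lemma marginal_density_ae :
  {ae m1, forall x, \int[m2]_y (f (x, y))%:E = (f1 x)%:E}.
Proof.
suff : ae_eq m1 setT (EFin \o f1) (fun x => \int[m2]_y (f (x, y))%:E).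
  by apply: filterS => x /(_ I) /= ->.
apply: integral_ae_eq => //.
- apply/integrableP; split; first exact/measurable_EFinP.
  under eq_integral do rewrite /= ger0_norm//.
  case: df1 => _ _ <-//; rewrite /pushforward preimage_setT.
  by rewrite (le_lt_trans (probability_le1 _ _))// ltry.
- exact: measurable_slice.
- move=> E _ mE; case: df1 => _ _ <-//.
  transitivity (pushforward P (rv_pair X Y) (E `*` setT)).
    by congr (P _); apply/seteqP; split => [w|w []].
  case: df => _ _ ->; last exact: measurableX.
  rewrite integral_mul_indic; last exact: measurableX.
  rewrite fubini_tonelli1//=; first last.
  - by move=> x; rewrite lee_fin mulr_ge0.
  - apply/measurable_EFinP/measurable_funM => //.
    by apply: measurable_indic; exact: measurableX.
  rewrite [RHS]integral_mkcond; apply: eq_integral => x _ /=.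
  rewrite patchE; case: ifPn => xE; apply: eq_integral || apply: integral0_eq.
    by move=> y _; rewrite indicE mem_set ?mulr1//; split => //; exact: set_mem.
  move=> y _; rewrite indicE memNset ?mulr0// => -[/= Ex _].
  by rewrite mem_set in xE.
Qed.

Lemma dkernelE B : measurable B ->
  {ae m1, forall x, \int[m2]_(y in B) (f (x, y))%:E = (K x B * f1 x)%:E}.
Proof.
move=> mB; apply: filterS marginal_density_ae => x fx.
have le1 : \int[m2]_(y in B) (f (x, y))%:E <= (f1 x)%:E.
  by rewrite -fx; apply: ge0_subset_integral => // y _; rewrite lee_fin.
have ge0 : 0 <= \int[m2]_(y in B) (f (x, y))%:E.
  by apply: integral_ge0 => y _; rewrite lee_fin.
(* Where [f1] vanishes the kernel is 0 by convention, and so is the slice integral, which [f1 x]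
   bounds. *)
rewrite /dkernel; have [f1x|f1x] := eqVneq (f1 x) 0%R.
  by rewrite f1x mulr0; apply/eqP; rewrite eq_le ge0 -f1x le1.
rewrite divfK// fineK// ge0_fin_numE//.
by rewrite (le_lt_trans le1)// ltry.
Qed.

Lemma rv_density_ae (A : set T1) :
  {ae m1, forall x, A x} -> {ae P, forall w, A (X w)}.
Proof.
move=> [N [mN N0 AN]]; apply: (@ae_distribution _ _ _ _ _ _ X).
exists N; split => //; case: df1 => _ _; rewrite /distribution => ->//.
by apply: null_set_integral => //; exact/measurable_EFinP/measurable_funTS.
Qed.

(** The defining property of a conditional distribution, tested on functions of X; by Tonelli both
    sides are the integral of 1_B(y) h(x) f(x, y). *)
Lemma tower (h : T1 -> R) B : measurable_fun setT h -> (forall x, (0 <= h x)%R) ->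
  measurable B ->
  \int[P]_w (\1_B (Y w) * h (X w))%:E = \int[P]_w (K (X w) B * h (X w))%:E.
Proof.
move=> mh h0 mB.
have mg : measurable_fun setT (fun z : T1 * T2 => (\1_B z.2 * h z.1)%R).
  apply: measurable_funM; last exact: measurableT_comp.
  by apply: measurableT_comp => //; exact: measurable_indic.
rewrite (rv_density_ge0_integral (U := rv_pair X Y)
  (g := fun z => (\1_B z.2 * h z.1)%:E) df)//; last 2 first.
- exact/measurable_EFinP.
- by move=> z; rewrite lee_fin mulr_ge0.
rewrite (rv_density_ge0_integral (U := X)
  (g := fun x => (K x B * h x)%:E) df1)//; last 2 first.
- by apply/measurable_EFinP/measurable_funM => //; exact: measurable_dkernel.
- by move=> x; rewrite lee_fin mulr_ge0 ?dkernel_ge0.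
under eq_integral do rewrite -EFinM.
rewrite fubini_tonelli1//; last 2 first.
- by apply/measurable_EFinP/measurable_funM.
- by move=> z; rewrite lee_fin !mulr_ge0.
have sliceE x : fubini_F m2 (fun z => (\1_B z.2 * h z.1 * f z)%:E) x =
    (h x)%:E * \int[m2]_(y in B) (f (x, y))%:E.
  rewrite /fubini_F [X in _ = _ * X]integral_mul_indic// -ge0_integralZl_EFin//.
  - by apply: eq_integral => y _; rewrite -EFinM; congr EFin => /=; ring.
  - by move=> y _; rewrite lee_fin mulr_ge0.
  - by apply/measurable_EFinP/measurable_funM.
transitivity (\int[m1]_x ((h x)%:E * \int[m2]_(y in B) (f (x, y))%:E)).
  by apply: eq_integral => x _; exact: sliceE.
apply: ge0_ae_eq_integral => //.
- apply: emeasurable_funM; last exact: measurable_slice.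
  exact/measurable_EFinP.
- apply: emeasurable_funM; apply/measurable_EFinP => //.
  by apply: measurable_funM => //; exact: measurable_dkernel.
- by move=> x _; rewrite mule_ge0 ?lee_fin ?integral_ge0// => y _; rewrite lee_fin.
- by move=> x _; rewrite -EFinM lee_fin; apply: mulr_ge0 => //;
  apply: mulr_ge0 => //; exact: dkernel_ge0.
- apply: filterS (dkernelE mB) => x -> _.
  by rewrite -!EFinM; congr EFin; ring.
Qed.

End conditional_density.

Section kernel_rectangle.
Local Open Scope ereal_scope.
Context d (T : measurableType d) (R : realType) (P : probability T R).
Context d0 d1 d2 (T0 : measurableType d0) (T1 : measurableType d1)
  (T2 : measurableType d2).
Variables (U : {mfun T >-> T0}) (phi : T0 -> T1).
Variables (X : {mfun T >-> T1}) (Y : {mfun T >-> T2}).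
Hypotheses (mphi : measurable_fun setT phi) (phiU : forall w, phi (U w) = X w).
Variables (m1 : {sigma_finite_measure set T1 -> \bar R})
  (m2 : {sigma_finite_measure set T2 -> \bar R}).
Variables (f1 : T1 -> R) (f : T1 * T2 -> R).
Hypotheses (df1 : is_density m1 (pushforward P X) f1)
  (df : is_density (m1 \x m2) (pushforward P (rv_pair X Y)) f).

Local Notation K := (dkernel m2 f f1).

(** The conditional density of Y given X, read as a function of Y and of a finer variable U that
    determines X through [phi]. It is integrated against the law of U times [m2], so U itself need
    not have a density. *)
Definition pulled_density (s : T0 * T2) : R := (f (phi s.1, s.2) / f1 (phi s.1))%R.

Lemma pulled_density_ge0 s : (0 <= pulled_density s)%R.
Proof. by case: df1 => _ ? _; case: df => _ ? _; exact: divr_ge0. Qed.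

Lemma measurable_pulled_density : measurable_fun setT pulled_density.
Proof.
case: df1 => mf1 f10 _; case: df => mf f0 _.
apply: measurable_fun_div_ge0 => //.
- apply: measurableT_comp => //; apply: measurable_fun_pair => //.
  exact: measurableT_comp.
- by do 2!apply: measurableT_comp => //.
Qed.

Lemma pulled_density_rectangle D C : measurable D -> measurable C ->
  \int[distribution P U \x m2]_(s in D `*` C) (pulled_density s)%:E =
  \int[P]_w (\1_D (U w) * K (X w) C)%:E.
Proof.
case: (df1) => mf1 f10 _; case: (df) => mf f0 _.
move=> mD mC; have mDC := measurableX mD mC.
have mg : measurable_fun setT (fun s => (pulled_density s * \1_(D `*` C) s)%:E).
  apply/measurable_EFinP/measurable_funM; first exact: measurable_pulled_density.
  exact: measurable_indic.
have g0 s : 0 <= (pulled_density s * \1_(D `*` C) s)%:E.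
  by rewrite lee_fin mulr_ge0// pulled_density_ge0.
rewrite integral_mul_indic// fubini_tonelli1//.
set G := fubini_F _ _.
have mG : measurable_fun setT G by exact: measurable_fun_fubini_tonelli_F.
have G0 s : 0 <= G s by apply: integral_ge0.
rewrite ge0_integral_distribution//.
apply: ge0_ae_eq_integral => //.
- by apply: measurableT_comp => //; exact: measurable_funPT.
- apply/measurable_EFinP/measurable_funM.
    by apply: measurableT_comp; [exact: measurable_indic|exact: measurable_funPT].
  by apply: (measurableT_comp (measurable_dkernel df1 df mC));
    exact: measurable_funPT.
- by move=> w _; exact: G0.
- by move=> w _; rewrite lee_fin; apply: mulr_ge0 => //;
  exact: dkernel_ge0 df1 df _ _.
have indX s y : \1_(D `*` C) (s, y) = (\1_D s * \1_C y)%R :> R.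
  by rewrite !indicE in_setX -natrM mulnb.
have KX := rv_density_ae df1 (dkernelE df1 df mC).
have X0 := rv_density_ae_gt0 df1.
near=> w => _.
have Kw : \int[m2]_(y in C) (f (X w, y))%:E = (K (X w) C * f1 (X w))%:E by near: w.
have Xw : (0 < f1 (X w))%R by near: w.
rewrite /= /G /fubini_F /pulled_density /= phiU.
transitivity ((\1_D (U w) / f1 (X w))%:E * \int[m2]_(y in C) (f (X w, y))%:E).
  rewrite [X in _ = _ * X]integral_mul_indic// -ge0_integralZl_EFin//.
  - apply: eq_integral => y _; rewrite -EFinM; congr EFin.
    by rewrite indX; ring.
  - by move=> y _; rewrite lee_fin mulr_ge0.
  - apply/measurable_EFinP/measurable_funM; last exact: measurable_indic.
    by apply: measurableT_comp => //; exact: measurable_fun_pair.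
  - by rewrite divr_ge0.
by rewrite Kw -EFinM; congr EFin; rewrite mulrACA mulVf ?lt0r_neq0// mulr1.
Unshelve. all: by end_near.
Qed.

End kernel_rectangle.

(** * Mutual information *)

Lemma density_unique_ae d (T : measurableType d) (R : realType)
    (m law : {measure set T -> \bar R}) (f g : T -> R) :
  (law setT < +oo)%E -> is_density m law f -> is_density m law g ->
  {ae m, forall x, f x = g x}.
Proof.
move=> lawoo [mf f0 fE] [mg g0 gE].
suff : ae_eq m setT (EFin \o f) (EFin \o g).
  by apply: filterS => x /(_ I) [].
apply: integral_ae_eq => //.
- apply/integrableP; split; first exact/measurable_EFinP.
  by under eq_integral do rewrite /= ger0_norm//; rewrite -fE.
- exact/measurable_EFinP.
- by move=> E _ mE; rewrite /= -fE// gE.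
Qed.

Lemma ae_eq_integrable d (T : measurableType d) (R : realType)
    (m : {measure set T -> \bar R}) (f g : T -> \bar R) :
  measurable_fun setT g -> ae_eq m setT f g -> m.-integrable setT f ->
  m.-integrable setT g.
Proof.
move=> mg fg /integrableP[mf foo]; apply/integrableP; split => //.
rewrite (_ : integral _ _ _ = \int[m]_x `|f x|)%E//.
apply: ge0_ae_eq_integral => //; [exact: measurableT_comp..|].
by apply: filterS fg => x fg /fg ->.
Qed.

Section mutual_information.
Local Open Scope ereal_scope.
Context d (T : measurableType d) (R : realType) (P : probability T R).
Context d1 d2 (T1 : measurableType d1) (T2 : measurableType d2).
Variables (X : {mfun T >-> T1}) (Y : {mfun T >-> T2}).
Variables (m1 : {sigma_finite_measure set T1 -> \bar R})
  (m2 : {sigma_finite_measure set T2 -> \bar R}).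

Definition information_density (f1 : T1 -> R) (f2 : T2 -> R) (f : T1 * T2 -> R)
  (z : T1 * T2) : R := ln (f z / (f1 z.1 * f2 z.2)).

(* The existential in [is_mutual_info], for random variables with values in
   arbitrary measurable types. *)
Definition mutual_info (f1 : T1 -> R) (f2 : T2 -> R) (f : T1 * T2 -> R) (v : R) :=
  [/\ is_density m1 (pushforward P X) f1,
      is_density m2 (pushforward P Y) f2,
      is_density (m1 \x m2) (pushforward P (rv_pair X Y)) f,
      (m1 \x m2).-integrable setT (fun z => (f z * information_density f1 f2 f
        z)%:E) &
      \int[m1 \x m2]_z (f z * information_density f1 f2 f z)%:E = v%:E].

Variables (f1 : T1 -> R) (f2 : T2 -> R) (f : T1 * T2 -> R) (v : R).
Hypothesis fv : mutual_info f1 f2 f v.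

Lemma measurable_information_density :
  measurable_fun setT (information_density f1 f2 f).
Proof.
case: fv => -[mf1 f10 _] [mf2 f20 _] [mf _ _] _ _.
apply: (measurableT_comp (@measurable_ln R)).
apply: measurable_fun_div_ge0 => //; last by move=> z; exact: mulr_ge0.
by apply: measurable_funM; apply: measurableT_comp.
Qed.

(** Moving the integral from the product of the reference measures to P allows the informations of
    different pairs to be subtracted under one integral. *)
Lemma integral_information_density :
  P.-integrable setT (fun w => (information_density f1 f2 f (X w, Y w))%:E) /\
  \int[P]_w (information_density f1 f2 f (X w, Y w))%:E = v%:E.
Proof.
case: fv => _ _ df ifv fvE; have mi := measurable_information_density.
have ifv' : (m1 \x m2).-integrable setT
    (fun z => (information_density f1 f2 f z * f z)%:E).
  by under eq_fun do rewrite mulrC.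
have [li lE] := @density_integral _ _ _ (m1 \x m2) (distribution P (rv_pair X Y))
  f df _ mi ifv'.
have miE : measurable_fun setT (EFin \o information_density f1 f2 f).
  exact/measurable_EFinP.
have iP : P.-integrable setT
    ((EFin \o information_density f1 f2 f) \o rv_pair X Y).
  apply/integrableP; split.
    by apply: measurableT_comp => //; exact: measurable_funPT.
  case/integrableP : li => _.
  by rewrite ge0_integral_distribution//=; apply/measurable_EFinP;
    exact: measurableT_comp.
split => //; rewrite -[LHS](integral_distribution (X := rv_pair X Y) miE iP) lE -fvE.
by apply: eq_integral => z _; rewrite mulrC.
Qed.

End mutual_information.

Section data_processing.
Local Open Scope ereal_scope.
Context d (T : measurableType d) (R : realType) (P : probability T R).
Context d1 d2 d3 (T1 : measurableType d1) (T2 : measurableType d2)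
  (T3 : measurableType d3).
Variables (X : {mfun T >-> T1}) (Y : {mfun T >-> T2}) (Z : {mfun T >-> T3}).
Variables (m1 : {sigma_finite_measure set T1 -> \bar R})
  (m2 : {sigma_finite_measure set T2 -> \bar R})
  (m3 : {sigma_finite_measure set T3 -> \bar R}).
Variables (fX : T1 -> R) (fZ : T3 -> R) (fXZ : T1 * T3 -> R) (vXZ : R).
Variables (fY : T2 -> R) (gZ : T3 -> R) (fYZ : T2 * T3 -> R) (vYZ : R).
Hypotheses (miXZ : mutual_info P X Z m1 m3 fX fZ fXZ vXZ)
  (miYZ : mutual_info P Y Z m2 m3 fY gZ fYZ vYZ).

(* [Z] is independent of [X] given [Y] : P(Z in C | X, Y) = P(Z in C | Y). *)
Hypothesis ciY : forall A B C, measurable A -> measurable B -> measurable C ->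
  P [set w | [/\ A (X w), B (Y w) & C (Z w)]] =
  \int[P]_w (\1_A (X w) * \1_B (Y w) * dkernel m3 fYZ fY (Y w) C)%:E.

Let U := rv_pair X Y.
Let n := distribution P U \x m3.
(** The conditional densities of Z given Y and given X, competing as densities of ((X, Y), Z) with
    respect to [n]. By [ciY] the first is one; the second is so far only known to have integral at
    most 1. *)
Let a : T1 * T2 * T3 -> R := pulled_density snd fY fYZ.
Let b : T1 * T2 * T3 -> R := pulled_density fst fX fXZ.

Let dX : is_density m1 (pushforward P X) fX. Proof. by case: miXZ. Qed.
Let dY : is_density m2 (pushforward P Y) fY. Proof. by case: miYZ. Qed.
Let dXZ : is_density (m1 \x m3) (pushforward P (rv_pair X Z)) fXZ.
Proof. by case: miXZ. Qed.
Let dYZ : is_density (m2 \x m3) (pushforward P (rv_pair Y Z)) fYZ.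
Proof. by case: miYZ. Qed.

Let ma : measurable_fun setT a.
Proof. exact: (measurable_pulled_density (X := Y) (Y := Z) _ dY dYZ). Qed.
Let a0 s : (0 <= a s)%R.
Proof. exact: (pulled_density_ge0 (X := Y) (Y := Z) _ dY dYZ). Qed.
Let mb : measurable_fun setT b.
Proof. exact: (measurable_pulled_density (X := X) (Y := Z) _ dX dXZ). Qed.
Let b0 s : (0 <= b s)%R.
Proof. exact: (pulled_density_ge0 (X := X) (Y := Z) _ dX dXZ). Qed.

Let da : is_density n (pushforward P (rv_pair U Z)) a.
Proof.
split => // S mS; apply: (measurable_box_unique
  (L1 := distribution P (rv_pair U Z)) (L2 := density_measure n ma a0)) => //.
  by rewrite (le_lt_trans (probability_le1 _ _))// ltry.
move=> A B C mA mB mC; transitivity (\int[n]_(s in A `*` B `*` C) (a s)%:E);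
  last by [].
rewrite (pulled_density_rectangle (X := Y) (Y := Z) _ _ dY dYZ)//;
  last exact: measurableX.
transitivity (P [set w | [/\ A (X w), B (Y w) & C (Z w)]]).
  by congr (P _); apply/seteqP; split => [w [[/= ? ?] ?]|w [? ? ?]].
rewrite ciY//; apply: eq_integral => w _; congr (_ * _)%:E.
by rewrite !indicE /U /rv_pair in_setX -natrM mulnb.
Qed.

Let b1 : \int[n]_s (b s)%:E <= 1.
Proof.
rewrite -setXTT.
rewrite (pulled_density_rectangle (X := X) (Y := Z) _ _ dX dXZ)//.
apply: (@le_trans _ _ (\int[P]_w (dkernel m3 fXZ fX (X w) setT * 1)%:E)).
  rewrite le_eqVlt; apply/orP; left; apply/eqP.
  by apply: eq_integral => w _; rewrite indicT mul1r mulr1.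
rewrite -(tower dX dXZ (h := cst 1%R))//.
under eq_integral do rewrite indicT mul1r.
by rewrite /= integral_cst// mul1e; exact: probability_le1.
Qed.

(** The marginal density of Z cancels in the difference; [fZ] and [gZ] are two versions of it. *)
Let log_ratio_ae : {ae P, forall w,
  (information_density fY gZ fYZ (Y w, Z w) - information_density fX fZ fXZ (X w,
    Z w) =
  ln (a (U w, Z w) / b (U w, Z w)))%R}.
Proof.
have [dZ eZ] : is_density m3 (pushforward P Z) fZ /\ is_density m3 (pushforward P
  Z) gZ.
  by split; [case: miXZ|case: miYZ].
have X0 := rv_density_ae_gt0 dX; have Y0 := rv_density_ae_gt0 dY.
have Z0 := rv_density_ae_gt0 dZ.
have XZ0 := rv_density_ae_gt0 (U := rv_pair X Z) dXZ.
have YZ0 := rv_density_ae_gt0 (U := rv_pair Y Z) dYZ.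
have ZE : {ae P, forall w, fZ (Z w) = gZ (Z w)}.
  apply: (rv_density_ae dZ (A := [set z | fZ z = gZ z])).
  apply: (density_unique_ae (law := distribution P Z)) => //.
  by rewrite (le_lt_trans (probability_le1 _ _))// ltry.
near=> w.
have Xw : (0 < fX (X w))%R by near: w.
have Yw : (0 < fY (Y w))%R by near: w.
have Zw : (0 < fZ (Z w))%R by near: w.
have XZw : (0 < fXZ (X w, Z w))%R by near: w.
have YZw : (0 < fYZ (Y w, Z w))%R by near: w.
have Ew : fZ (Z w) = gZ (Z w) by near: w.
rewrite /information_density /a /b /pulled_density /U /rv_pair /= -Ew -ln_div;
  first last.
- by rewrite posrE divr_gt0// mulr_gt0.
- by rewrite posrE divr_gt0// mulr_gt0.
congr ln; field; do !(apply/andP; split); exact: lt0r_neq0.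
Unshelve. all: by end_near. Qed.

(** The expectation of [ln (a / b)] is [vYZ - vXZ], so [vYZ <= vXZ] puts Gibbs' inequality in its
    equality case: [b] is a density too, and Z is independent of Y given X. *)
Lemma data_processing_equality : (vYZ <= vXZ)%R ->
  forall A B C, measurable A -> measurable B -> measurable C ->
  P [set w | [/\ A (X w), B (Y w) & C (Z w)]] =
  \int[P]_w (\1_A (X w) * \1_B (Y w) * dkernel m3 fXZ fX (X w) C)%:E.
Proof.
move=> vle A B C mA mB mC.
have [iXZ XZE] := integral_information_density miXZ.
have [iYZ YZE] := integral_information_density miYZ.
have iB := integrableB measurableT iYZ iXZ.
have mln : measurable_fun setT (fun w => (ln (a (U w, Z w) / b (U w, Z w)))%:E).
  apply/measurable_EFinP/(measurableT_comp (@measurable_ln R)).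
  apply: (measurableT_comp (measurable_fun_div_ge0 ma mb b0)
    (g := rv_pair U Z)).
  exact: measurable_funPT.
have lnE : ae_eq P setT
    (fun w => (information_density fY gZ fYZ (Y w, Z w))%:E -
              (information_density fX fZ fXZ (X w, Z w))%:E)
    (fun w => (ln (a (U w, Z w) / b (U w, Z w)))%:E).
  by apply: filterS log_ratio_ae => w + _; rewrite -EFinB => ->.
have lnI : \int[P]_w (ln (a (U w, Z w) / b (U w, Z w)))%:E = (vYZ - vXZ)%:E.
  rewrite EFinB -XZE -YZE -integralB//; apply/esym.
  by apply: ae_eq_integral lnE => //; exact: measurable_int iB.
have [_ _ bE] : is_density n (pushforward P (rv_pair U Z)) b.
  apply: gibbs_density da mb b0 b1 _ _ _.
  - have X0 := rv_density_ae_gt0 dX.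
    have XZ0 := rv_density_ae_gt0 (U := rv_pair X Z) dXZ.
    near=> w; rewrite /b /pulled_density divr_gt0//; near: w; [exact: XZ0|exact: X0].
  - exact: ae_eq_integrable mln lnE iB.
  - by apply: le_trans (_ : (vYZ - vXZ)%:E <= 0);
    [rewrite -lnI|rewrite lee_fin subr_le0].
transitivity (pushforward P (rv_pair U Z) (A `*` B `*` C)).
  by congr (P _); apply/seteqP; split => [w [? ? ?]|w [[/= ? ?] ?]].
rewrite bE; last by apply: measurableX => //; exact: measurableX.
rewrite (pulled_density_rectangle (X := X) (Y := Z) _ _ dX dXZ)//;
  last exact: measurableX.
apply: eq_integral => w _; congr (_ * _)%:E.
by rewrite !indicE /U /rv_pair in_setX -natrM mulnb.
Unshelve. all: by end_near. Qed.

End data_processing.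

(** * Independence and vanishing mutual information *)

Section independence.
Local Open Scope ereal_scope.
Context d (T : measurableType d) (R : realType) (P : probability T R).
Context d1 d2 (T1 : measurableType d1) (T2 : measurableType d2).
Variables (X : {mfun T >-> T1}) (Y : {mfun T >-> T2}).
Variables (m1 : {sigma_finite_measure set T1 -> \bar R})
  (m2 : {sigma_finite_measure set T2 -> \bar R}).
Variables (f1 : T1 -> R) (f2 : T2 -> R) (f : T1 * T2 -> R) (v : R).
Hypothesis fv : mutual_info P X Y m1 m2 f1 f2 f v.

Let prod_density (z : T1 * T2) := (f1 z.1 * f2 z.2)%R.

Let m_prod : measurable_fun setT prod_density.
Proof.
case: fv => -[mf1 _ _] [mf2 _ _] _ _ _.
by apply: measurable_funM; apply: measurableT_comp.
Qed.

Let prod_ge0 z : (0 <= prod_density z)%R.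
Proof. by case: fv => -[_ ? _] [_ ? _] _ _ _; exact: mulr_ge0. Qed.

Let prod_rectangle A B : measurable A -> measurable B ->
  \int[m1 \x m2]_(z in A `*` B) (prod_density z)%:E =
  P (X @^-1` A) * P (Y @^-1` B).
Proof.
case: fv => -[mf1 f10 f1E] [mf2 f20 f2E] _ _ _ mA mB.
rewrite integral_mul_indic; last exact: measurableX.
rewrite fubini_tonelli1//; first last.
- by move=> z; rewrite lee_fin mulr_ge0.
- by apply/measurable_EFinP/measurable_funM => //; apply: measurable_indic;
  exact: measurableX.
transitivity (\int[m1]_x ((f1 x * \1_A x)%:E * P (Y @^-1` B))).
  apply: eq_integral => x _.
  have -> : P (Y @^-1` B) = \int[m2]_y (f2 y * \1_B y)%:E.
    by rewrite -integral_mul_indic//; exact: f2E.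
  rewrite -ge0_integralZl_EFin//.
  - apply: eq_integral => y _; rewrite -EFinM; congr EFin.
    by rewrite /prod_density !indicE in_setX -mulnb natrM /=; ring.
  - by move=> y _; rewrite lee_fin mulr_ge0.
  - by apply/measurable_EFinP/measurable_funM => //; exact: measurable_indic.
  - by rewrite mulr_ge0.
rewrite ge0_integralZr//.
- by rewrite -integral_mul_indic// -f1E.
- by apply/measurable_EFinP/measurable_funM => //; exact: measurable_indic.
- by move=> x _; rewrite lee_fin mulr_ge0.
Qed.

Lemma mutual_info_le0_indep : (v <= 0)%R ->
  forall A B, measurable A -> measurable B ->
  P (X @^-1` A `&` Y @^-1` B) = P (X @^-1` A) * P (Y @^-1` B).
Proof.
move=> v0 A B mA mB; have [iP PE] := integral_information_density fv.
case: (fv) => df1 df2 df _ _.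
rewrite -prod_rectangle//.
have [_ _ <-//] : is_density (m1 \x m2) (pushforward P (rv_pair X Y)) prod_density.
  apply: gibbs_density df m_prod prod_ge0 _ _ iP _; last by rewrite PE lee_fin.
  - by rewrite -setXTT prod_rectangle// !preimage_setT probability_setT mule1.
  - have X0 := rv_density_ae_gt0 df1; have Y0 := rv_density_ae_gt0 df2.
    by near=> w; rewrite mulr_gt0//; near: w; [exact: X0|exact: Y0].
exact: measurableX.
Unshelve. all: by end_near. Qed.

Lemma indep_mutual_info_eq0 :
  (forall A B, measurable A -> measurable B ->
    P (X @^-1` A `&` Y @^-1` B) = P (X @^-1` A) * P (Y @^-1` B)) -> v = 0%R.
Proof.
move=> indep; have [iP PE] := integral_information_density fv.
case: (fv) => df1 df2 df _ vE.
have dp : is_density (m1 \x m2) (pushforward P (rv_pair X Y)) prod_density.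
  split => // S mS; apply: (measurable_rectangle_unique
    (L1 := distribution P (rv_pair X Y)) (L2 := density_measure _ m_prod
      prod_ge0)) => //.
    by rewrite (le_lt_trans (probability_le1 _ _))// ltry.
  move=> A B mA mB.
  transitivity (\int[m1 \x m2]_(z in A `*` B) (prod_density z)%:E); last by [].
  by rewrite prod_rectangle// -indep.
have fE : {ae m1 \x m2, forall z, f z = prod_density z}.
  apply: (density_unique_ae (law := distribution P (rv_pair X Y))) => //.
  by rewrite (le_lt_trans (probability_le1 _ _))// ltry.
apply: EFin_inj; rewrite -vE; apply: etrans (integral0 (m1 \x m2) setT).
have mi := measurable_information_density fv.
have [mf f0 _] := df.
apply: ae_eq_integral => //; first by apply/measurable_EFinP/measurable_funM.
apply: filterS fE => z fz _; rewrite /information_density fz /prod_density.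
(* Where the product of the marginals vanishes so does [f]; elsewhere the logarithm is [ln 1]. *)
have [->|z0] := eqVneq (f1 z.1 * f2 z.2)%R 0%R; first by rewrite mul0r.
by rewrite divff// ln1 mulr0.
Qed.

End independence.

(** * Conditional independence of coordinates *)

Lemma integral_probability_cst d (T : measurableType d) (R : realType)
  (P : probability T R) (c : R) : (\int[P]_x c%:E = c%:E)%E.
Proof.
by rewrite integral_cst// -[RHS]mule1; congr (_ * _)%E; exact: probability_setT.
Qed.

Section coordinates.
Context (R : realType) (p : nat).

Definition coord (i : 'I_p) (x : vec R p) : measurableTypeR R := tnth x i.

Let measurable_coord i : measurable_fun setT (coord i).
Proof. exact: measurable_tnth. Qed.

HB.instance Definition _ i :=
  isMeasurableFun.Build _ _ _ _ (coord i) (measurable_coord i).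

Lemma measurable_coord_preimage i (A : set (measurableTypeR R)) :
  measurable A -> measurable (coord i @^-1` A).
Proof. by move=> mA; rewrite -[X in measurable X]setTI; exact: measurable_coord. Qed.

Lemma sigma_coord_measurable C (E : set (vec R p)) :
  sigma_coord C E -> measurable E.
Proof.
apply: smallest_sub; first exact: sigma_algebra_measurable.
by move=> _ [i iC [B mB ->]]; exact: measurable_coord_preimage.
Qed.

Lemma sigma_coord_preimage (C : {set 'I_p}) i (A : set (measurableTypeR R)) :
  i \in C -> measurable A -> sigma_coord C (coord i @^-1` A).
Proof. by move=> iC mA; apply: sub_sigma_algebra; exists i => //; exists A. Qed.

Lemma sigma_coord1P k (E : set (vec R p)) : sigma_coord [set k]%SET E ->
  exists2 B : set (measurableTypeR R), measurable B & E = coord k @^-1` B.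
Proof.
apply: (smallest_sub (X := [set E | exists2 B : set (measurableTypeR R),
  measurable B & E = coord k @^-1` B])); last first.
  by move=> _ [i /finset.set1P -> [B mB ->]]; exists B.
split.
- by exists set0 => //; rewrite preimage_set0.
- move=> _ [B mB ->]; exists (~` B); first exact: measurableC.
  by rewrite setTD.
- move=> F FB; have /choice[B BP] : forall n, exists B : set (measurableTypeR R),
      measurable B /\ F n = coord k @^-1` B.
    by move=> n; have [B mB FE] := FB n; exists B.
  exists (\bigcup_n B n).
    by apply: bigcup_measurable => n _; case: (BP n).
  by rewrite preimage_bigcup; apply: eq_bigcupr => n _; case: (BP n).
Qed.

Lemma sigma_coord0P (E : set (vec R p)) : sigma_coord finset.set0 E ->
  E = set0 \/ E = setT.
Proof.
apply: (smallest_sub (X := [set E | E = set0 \/ E = setT])); last first.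
  by move=> E' [i]; rewrite finset.in_set0.
split; first by left.
- by move=> _ [->|->]; rewrite setTD; [right; exact: setC0|left; exact: setCT].
- move=> F F0T; have [[n Fn]|nF] := pselect (exists n, F n = setT).
    by right; apply/seteqP; split => // x _; exists n => //; rewrite Fn.
  left; apply/seteqP; split => // x [n _ Fnx].
  by case: (F0T n) => FE; [rewrite FE in Fnx|apply: nF; exists n].
Qed.

Variable P : probability (vec R p) R.

(** The event [g < h] lies in the conditioning sigma-algebra, so [g] and [h] have the same integral
    over it although [h - g] is positive there. *)
Lemma cond_prob_lt0 C E g h :
  measurable E -> is_cond_prob P C E g -> is_cond_prob P C E h ->
  P [set x | g x < h x] = 0%E.
Proof.
move=> mE [mg ig gE] [mh ih hE]; set D := [set x | g x < h x].
have sD : sigma_coord C D.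
  pose G := [set E : set (vec R p) | exists2 i, i \in C &
    exists2 B : set (measurableTypeR R), measurable B & E = (fun x => tnth x i)
      @^-1` B].
  have mgG : measurable_fun setT (g : g_sigma_algebraType G -> measurableTypeR R).
    by move=> _ B mB; rewrite setTI; exact: mg.
  have mhG : measurable_fun setT (h : g_sigma_algebraType G -> measurableTypeR R).
    by move=> _ B mB; rewrite setTI; exact: mh.
  have := measurable_fun_ltr mgG mhG measurableT (Y := [set true]) I.
  by rewrite setTI; congr (G.-sigma.-measurable _); apply/seteqP; split.
have mD := sigma_coord_measurable sD.
have igD := integrableS measurableT mD (@subsetT _ D) ig.
have ihD := integrableS measurableT mD (@subsetT _ D) ih.
have : (\int[P]_(x in D) `|(h x)%:E - (g x)%:E| = 0)%E.
  rewrite (eq_integral (fun x => (h x)%:E - (g x)%:E)%E); last first.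
    by move=> x /[!inE] Dx; rewrite gee0_abs// -EFinB lee_fin subr_ge0 ltW.
  rewrite integralB//= hE// gE// subee//.
  by apply: fin_num_measure; exact: measurableI.
have mhg : measurable_fun D (fun x => (h x)%:E - (g x)%:E)%E.
  by apply: emeasurable_funB; [exact: measurable_int ihD|exact: measurable_int igD].
move/(ae_eq_integral_abs P mD mhg) => [N [mN N0 DN]].
apply: (subset_measure0 mD mN _ N0) => x Dx; apply: DN => /= /(_ Dx) /eqP.
by rewrite -EFinB eqe subr_eq0 => /eqP hg; move: Dx; rewrite /D /= hg ltxx.
Qed.

Lemma cond_prob_unique C E g h : measurable E ->
  is_cond_prob P C E g -> is_cond_prob P C E h -> {ae P, forall x, g x = h x}.
Proof.
move=> mE gE hE; have [[_ ig _] [_ ih _]] := (gE, hE).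
have mlt (u v : vec R p -> R) : P.-integrable setT (EFin \o u) ->
    P.-integrable setT (EFin \o v) -> measurable [set x | u x < v x].
  move=> /measurable_int/measurable_EFinP mu /measurable_int/measurable_EFinP mv.
  have := measurable_fun_ltr mu mv measurableT (Y := [set true]) I.
  by rewrite setTI; congr (measurable _); apply/seteqP; split.
exists ([set x | g x < h x] `|` [set x | h x < g x]); split.
- by apply: measurableU; exact: mlt.
- apply/eqP; rewrite eq_le measure_ge0 andbT.
  apply: (le_trans (measureU2 _ _ _)); [exact: mlt..|].
  by rewrite [X in (X + _)%E](cond_prob_lt0 mE gE hE) [X in (_ +
    X)%E](cond_prob_lt0 mE hE gE) adde0.
- move=> x /= /eqP; rewrite neq_lt => /orP[]; [by left|by right].
Qed.

Lemma is_cond_prob_cst E : measurable E ->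
  is_cond_prob P finset.set0 E (cst (fine (P E))).
Proof.
move=> mE; have PE : P E \is a fin_num by exact: fin_num_measure.
split.
- move=> B _; rewrite preimage_cst; case: ifPn => _.
    by rewrite -[X in sigma_coord _ X]setC0 -setTD; apply: sigma_algebraCD;
      exact: sigma_algebra0.
  exact: sigma_algebra0.
- exact: finite_measure_integrable_cst.
- move=> D /sigma_coord0P[] ->; first by rewrite integral_set0 setI0 measure0.
  by rewrite /= integral_probability_cst setIT fineK.
Qed.

(** Measurability for the trivial sigma-algebra forces [g] to be constant everywhere, not only
    almost surely. *)
Lemma is_cond_prob0P E g : is_cond_prob P finset.set0 E g ->
  g = cst (fine (P E)).
Proof.
move=> [mg ig gE]; pose c := g point.
have gc : g = cst c.
  have [g0|gT] := sigma_coord0P (mg _ (measurable_set1 c)).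
    have : (g @^-1` [set c]) point by [].
    by rewrite g0.
  by apply/funext => x; have : (g @^-1` [set c]) x by rewrite gT.
have [gT] : c%:E = P E.
  rewrite -[E]setIT -gE; last first.
    by rewrite -setC0 -setTD; apply: sigma_algebraCD; exact: sigma_algebra0.
  by rewrite gc /= integral_probability_cst.
by rewrite gc /= -gT.
Qed.

Lemma cond_indep0P (A B : {set 'I_p}) : cond_indep P A B finset.set0 <->
  forall E F, sigma_coord A E -> sigma_coord B F ->
    P (E `&` F) = (P E * P F)%E.
Proof.
split=> [ci E F AE BF|ind E F AE BF].
  have [mE mF] := (sigma_coord_measurable AE, sigma_coord_measurable BF).
  have [g [h [gE hF ghEF]]] := ci E F AE BF.
  have := is_cond_prob0P ghEF; rewrite (is_cond_prob0P gE) (is_cond_prob0P hF).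
  move=> /(congr1 (fun u => (u point)%:E)) /=; rewrite EFinM !fineK//.
  - by apply: fin_num_measure; exact: measurableI.
  - exact: fin_num_measure.
  - exact: fin_num_measure.
have [mE mF] := (sigma_coord_measurable AE, sigma_coord_measurable BF).
exists (cst (fine (P E))), (cst (fine (P F))); split; [exact: is_cond_prob_cst..|].
rewrite (_ : (fun x => _) = cst (fine (P (E `&` F)))).
  by apply: is_cond_prob_cst; exact: measurableI.
by apply/funext => x /=; rewrite ind// fineM//; exact: fin_num_measure.
Qed.

End coordinates.

(** * Exchanging the factors of a product measure *)

Section swap_integral.
Local Open Scope ereal_scope.
Context d1 d2 (T1 : measurableType d1) (T2 : measurableType d2) (R : realType).
Variables (m1 : {sigma_finite_measure set T1 -> \bar R})
  (m2 : {sigma_finite_measure set T2 -> \bar R}).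

Let msw : measurable_fun [set: T1 * T2] (@swap T1 T2).
Proof. exact: measurable_swap. Qed.

Lemma product_measure_swap (S : set (T2 * T1)) : measurable S ->
  (m2 \x m1) S = pushforward (m1 \x m2) (@swap T1 T2) S.
Proof.
move=> mS; apply: (@product_measure_unique _ _ _ _ _ m2 m1 (pushforward (m1 \x
  m2) (@swap T1 T2))) => //.
move=> A B mA mB; rewrite muleC -product_measure1E//.
by congr ((m1 \x m2) _); apply/seteqP; split => -[x y] [].
Qed.

Lemma ge0_integral_swap (S : set (T2 * T1)) (g : T2 * T1 -> \bar R) :
  measurable S -> measurable_fun S g -> (forall z, 0 <= g z) ->
  \int[m2 \x m1]_(z in S) g z = \int[m1 \x m2]_(z in @swap T1 T2 @^-1` S) g (swap z).
Proof.
move=> mS mg g0.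
rewrite (eq_measure_integral (pushforward (m1 \x m2) (@swap T1 T2))); last first.
  by move=> A mA _; exact: product_measure_swap.
by rewrite ge0_integral_pushforward.
Qed.

Lemma integral_swap (g : T1 * T2 -> \bar R) : (m1 \x m2).-integrable setT g ->
  (m2 \x m1).-integrable setT (g \o @swap T2 T1) /\
  \int[m2 \x m1]_z g (swap z) = \int[m1 \x m2]_z g z.
Proof.
move=> ig; have mg := measurable_int _ ig.
have mgs : measurable_fun setT (g \o @swap T2 T1).
  by apply: measurableT_comp => //; exact: measurable_swap.
have gE : g = (g \o @swap T2 T1) \o @swap T1 T2 by apply/funext => -[].
split.
  apply/integrableP; split => //.
  rewrite ge0_integral_swap//; last exact: measurableT_comp.
  case/integrableP : ig => _; rewrite preimage_setT; congr (_ < _).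
  by apply: eq_integral => -[].
rewrite (eq_measure_integral (pushforward (m1 \x m2) (@swap T1 T2))); last first.
  by move=> A mA _; exact: product_measure_swap.
rewrite -[LHS]/(\int[_]_z (g \o @swap T2 T1) z) integral_pushforward//.
- by rewrite preimage_setT -gE.
- by rewrite preimage_setT -gE.
Qed.

End swap_integral.

(** * Conditional independence and mutual information of the coordinates *)

Section coordinate_information.
Context (R : realType) (p : nat) (mu : line_measures R p)
  (P : probability (vec R p) R).

Lemma is_mutual_info_coord i j v : is_mutual_info mu P i j v ->
  exists fi fj fij,
    mutual_info P (coord i) (coord j) (mu i) (mu j) fi fj fij v.
Proof. by move=> [fi [fj [fij fv]]]; exists fi, fj, fij. Qed.

Lemma is_cond_prob_dkernel (k i : 'I_p) fk fki (A : set (measurableTypeR R)) :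
  is_density (mu k) (pushforward P (coord k)) fk ->
  is_density (mu k \x mu i)%E (pushforward P (rv_pair (coord k) (coord i))) fki ->
  measurable A ->
  is_cond_prob P [set k]%SET (coord i @^-1` A)
    (fun w => dkernel (mu i) fki fk (coord k w) A).
Proof.
move=> dk dki mA; have mK := measurable_dkernel dk dki mA.
have K0 x : 0 <= dkernel (mu i) fki fk x A := dkernel_ge0 dk dki x A.
have mKk : measurable_fun setT (fun w => dkernel (mu i) fki fk (coord k w) A).
  exact: (measurableT_comp mK (measurable_funPT _)).
have KE B : measurable B ->
    (\int[P]_(w in coord k @^-1` B) (dkernel (mu i) fki fk (coord k w) A)%:E =
     P (coord i @^-1` A `&` coord k @^-1` B))%E.
  move=> mB; rewrite integral_mul_indic; last exact: measurable_coord_preimage.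
  transitivity (\int[P]_w
      (dkernel (mu i) fki fk (coord k w) A * \1_B (coord k w))%:E)%E.
    by apply: eq_integral => w _; rewrite !indicE.
  rewrite -(tower dk dki)//.
  rewrite -integral_indic; do ?exact: measurable_coord_preimage.
  rewrite [RHS]integral_mul_indic; last exact: measurable_coord_preimage.
  by apply: eq_integral => w _; rewrite !indicE.
split.
- move=> B mB; apply: (sigma_coord_preimage (A := (dkernel (mu i) fki fk ^~ A)
  @^-1` B)).
    by rewrite finset.set11.
  by rewrite -[X in measurable X]setTI; exact: mK.
- apply/integrableP; split; first exact/measurable_EFinP.
  under eq_integral do rewrite /= ger0_norm//.
  rewrite -(preimage_setT (coord k)) KE// (le_lt_trans (probability_le1 _ _)) ?ltry//.
  by apply: measurableI => //; exact: measurable_coord_preimage.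
- by move=> D /sigma_coord1P[B mB ->]; exact: KE.
Qed.

(* [i] is independent of [j] given [k], in the form P(X_j in C | X_i, X_k) =
   P(X_j in C | X_k). *)
Lemma cond_indep1_kernel (i j k : 'I_p) fk fki fk' fkj :
  is_density (mu k) (pushforward P (coord k)) fk ->
  is_density (mu k \x mu i)%E (pushforward P (rv_pair (coord k) (coord i))) fki ->
  is_density (mu k) (pushforward P (coord k)) fk' ->
  is_density (mu k \x mu j)%E (pushforward P (rv_pair (coord k) (coord j))) fkj ->
  cond_indep P [set i]%SET [set j]%SET [set k]%SET <->
  forall A B C : set (measurableTypeR R), measurable A -> measurable B ->
    measurable C ->
    P [set w | [/\ A (coord i w), B (coord k w) & C (coord j w)]] =
    (\int[P]_w (\1_A (coord i w) * \1_B (coord k w) *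
       dkernel (mu j) fkj fk' (coord k w) C)%:E)%E.
Proof.
move=> dk dki dk' dkj.
have tripleE (A B C : set (measurableTypeR R)) :
    [set w | [/\ A (coord i w), B (coord k w) & C (coord j w)]] =
    coord i @^-1` A `&` coord j @^-1` C `&` coord k @^-1` B.
  by apply/seteqP; split => [w [? ? ?]|w [[? ?] ?]].
(* With the indicator of B times the kernel of j as test function, [tower] exchanges the kernel of i
   for the indicator of the event that X_i is in A. *)
have productE (A B C : set (measurableTypeR R)) : measurable A -> measurable B ->
    measurable C ->
    (\int[P]_(w in coord k @^-1` B) (dkernel (mu i) fki fk (coord k w) A *
       dkernel (mu j) fkj fk' (coord k w) C)%:E =
     \int[P]_w (\1_A (coord i w) * \1_B (coord k w) *
       dkernel (mu j) fkj fk' (coord k w) C)%:E)%E.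
  move=> mA mB mC; rewrite integral_mul_indic; last exact: measurable_coord_preimage.
  transitivity (\int[P]_w (dkernel (mu i) fki fk (coord k w) A *
      (\1_B (coord k w) * dkernel (mu j) fkj fk' (coord k w) C))%:E)%E.
    apply: eq_integral => w _;
      rewrite (_ : \1_(_ @^-1` _) w = \1_B (coord k w)) ?indicE//.
    by congr EFin; ring.
  rewrite -(tower dk dki (h := fun x => \1_B x * dkernel (mu j) fkj fk' x C))//.
  - by apply: eq_integral => w _; rewrite mulrA.
  - by apply: measurable_funM;
    [exact: measurable_indic|exact: measurable_dkernel dk' dkj _ mC].
  - by move=> x; apply: mulr_ge0 => //; exact: dkernel_ge0 dk' dkj _ _.
have ii : i \in [set i]%SET by rewrite finset.set11.
have jj : j \in [set j]%SET by rewrite finset.set11.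
have kk : k \in [set k]%SET by rewrite finset.set11.
split=> [ci A B C mA mB mC|kernelE E F /sigma_coord1P[A mA ->] /sigma_coord1P[C
  mC ->]].
- have gA := is_cond_prob_dkernel dk dki mA.
  have hC := is_cond_prob_dkernel dk' dkj mC.
  have [mXA mXC] := (measurable_coord_preimage i mA, measurable_coord_preimage j mC).
  have [g [h [gE hE [mgh igh ghE]]]] :=
    ci _ _ (sigma_coord_preimage ii mA) (sigma_coord_preimage jj mC).
  (* The versions provided by [cond_indep] are arbitrary; almost sure uniqueness exchanges them for
     the kernels. *)
  have gg := cond_prob_unique mXA gE gA; have hh := cond_prob_unique mXC hE hC.
  rewrite tripleE -(ghE _ (sigma_coord_preimage kk mB)) -productE//.
  apply: ae_eq_integral.
  + exact: measurable_coord_preimage.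
  + exact: measurable_funTS (measurable_int _ igh).
  + apply/measurable_EFinP/measurable_funTS/measurable_funM.
      exact: (measurableT_comp (measurable_dkernel dk dki mA) (measurable_funPT _)).
    exact: (measurableT_comp (measurable_dkernel dk' dkj mC) (measurable_funPT _)).
  + by near=> w => _; congr ((_ * _)%:E); near: w; [exact: gg|exact: hh].
- exists (fun w => dkernel (mu i) fki fk (coord k w) A),
    (fun w => dkernel (mu j) fkj fk' (coord k w) C).
  split; [exact: is_cond_prob_dkernel|exact: is_cond_prob_dkernel|].
  have mK : measurable_fun setT (fun x => dkernel (mu i) fki fk x A *
      dkernel (mu j) fkj fk' x C).
    by apply: measurable_funM; [exact: measurable_dkernel dk dki _ mA|
      exact: measurable_dkernel dk' dkj _ mC].
  have KE B : measurable B -> (\int[P]_(w in coord k @^-1` B)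
      (dkernel (mu i) fki fk (coord k w) A * dkernel (mu j) fkj fk' (coord k w)
        C)%:E =
      P (coord i @^-1` A `&` coord j @^-1` C `&` coord k @^-1` B))%E.
    by move=> mB; rewrite productE// -kernelE// tripleE.
  split.
  + move=> B mB; apply: (sigma_coord_preimage (i := k)
      (A := (fun x => dkernel (mu i) fki fk x A * dkernel (mu j) fkj fk' x C)
        @^-1` B)) => //.
    by rewrite -[X in measurable X]setTI; exact: mK.
  + apply/integrableP; split.
      apply/measurable_EFinP; exact: (measurableT_comp mK (measurable_funPT _)).
    under eq_integral => w _.
      rewrite /= ger0_norm; last first.
        by apply: mulr_ge0; [exact: dkernel_ge0 dk dki _ _|exact: dkernel_ge0 dk'
          dkj _ _].
      over.
    rewrite -(preimage_setT (coord k)) KE// (le_lt_trans (probability_le1 _ _))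
      ?ltry//.
    by do 2?[apply: measurableI]; exact: measurable_coord_preimage.
  + by move=> D /sigma_coord1P[B mB ->]; exact: KE.
Unshelve. all: by end_near. Qed.

(** Otherwise the equality case of data processing would make X_k and X_j independent given X_i. The
    informations of the pair i, k supply its joint densities, in both orders, by which the two
    conditional independences are expressed through kernels. *)
Lemma mutual_info_lt (i j k : 'I_p) vij vkj vki vik :
  is_mutual_info mu P i j vij -> is_mutual_info mu P k j vkj ->
  is_mutual_info mu P k i vki -> is_mutual_info mu P i k vik ->
  cond_indep P [set i]%SET [set j]%SET [set k]%SET ->
  ~ cond_indep P [set k]%SET [set j]%SET [set i]%SET -> vij < vkj.
Proof.
move=> /is_mutual_info_coord[fi [fj [fij mij]]].
move=> /is_mutual_info_coord[fk [fj' [fkj mkj]]].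
move=> /is_mutual_info_coord[gk [gi [gki [dgk _ dgki _ _]]]].
move=> /is_mutual_info_coord[hi [hk [hik [dhi _ dhik _ _]]]].
have [dfi _ dfij _ _] := mij; have [dfk _ dfkj _ _] := mkj.
move=> /(cond_indep1_kernel dgk dgki dfk dfkj) ciY nci.
rewrite ltNge; apply/negP => vle; apply: nci.
apply/(cond_indep1_kernel dhi dhik dfi dfij) => B A C mB mA mC.
have := data_processing_equality mij mkj ciY vle mA mB mC.
rewrite (_ : [set w | [/\ A (coord i w), B (coord k w) & C (coord j w)]] =
  [set w | [/\ B (coord k w), A (coord i w) & C (coord j w)]]); last first.
  by apply/seteqP; split => w [? ? ?].
by move=> ->; apply: eq_integral => w _; rewrite (mulrC (\1_A _)).
Qed.

Lemma mutual_info_indep (i j : 'I_p) v : is_mutual_info mu P i j v ->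
  cond_indep P [set i]%SET [set j]%SET finset.set0 -> v = 0.
Proof.
move=> /is_mutual_info_coord[fi [fj [fij mij]]] /cond_indep0P ind.
apply: indep_mutual_info_eq0 mij _ => A B mA mB.
by apply: ind; apply: sigma_coord_preimage; rewrite ?finset.set11.
Qed.

Lemma mutual_info_dep (i j : 'I_p) v : is_mutual_info mu P i j v ->
  ~ cond_indep P [set i]%SET [set j]%SET finset.set0 -> 0 < v.
Proof.
move=> /is_mutual_info_coord[fi [fj [fij mij]]] dep.
rewrite ltNge; apply/negP => v0; apply: dep; apply/cond_indep0P.
move=> E F /sigma_coord1P[A mA ->] /sigma_coord1P[B mB ->].
exact: mutual_info_le0_indep mij v0 _ _ mA mB.
Qed.

Lemma is_mutual_info_sym (i j : 'I_p) v :
  is_mutual_info mu P i j v -> is_mutual_info mu P j i v.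
Proof.
move=> [fi [fj [fij [di dj [mf f0 fE] iv vE]]]].
exists fj, fi, (fij \o @swap _ _) => integrand.
have integrandE : integrand = (fun z => (fij z * ln (fij z / (fi z.1 * fj z.2)))%:E)
    \o @swap _ _.
  by apply/funext => -[x y]; rewrite /integrand /= (mulrC (fj _)).
have [ivs vEs] := integral_swap iv.
have mfs : measurable_fun setT (fij \o @swap _ _).
  by apply: measurableT_comp => //; exact: measurable_swap.
split => //; [split => // [z|S mS];
  first exact: f0|by rewrite integrandE|by rewrite integrandE vEs].
rewrite ge0_integral_swap//.
- transitivity (pushforward P (fun x :
  vec R p => (tnth x i, tnth x j)) (@swap _ _ @^-1` S)).
    by [].
  rewrite fE; last by rewrite -[X in measurable X]setTI; exact: measurable_swap.
  by apply: eq_integral => -[].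
- exact/measurable_EFinP/measurable_funTS.
- by move=> z; rewrite lee_fin; exact: f0.
Qed.

End coordinate_information.

(** * Trees *)

Section connectivity.
Context (T : finType).

(** However often the new edge is used, only the pieces before its first use and after its last use
    matter. *)
Lemma connect_add_edge (e : rel T) a b x y :
  connect [rel u v | [|| e u v, (u == a) && (v == b) | (u == b) && (v == a)]] x y ->
  [\/ connect e x y, connect e x a /\ connect e b y |
      connect e x b /\ connect e a y].
Proof.
move=> /connectP[p + ->] {y}; elim: p x => [|z p IHp] x /=.
  by move=> _; constructor 1.
move=> /andP[exz /IHp {IHp}].
case/or3P: exz => [exz|/andP[/eqP -> /eqP ->]|/andP[/eqP -> /eqP ->]].
- have xz := connect1 exz.
  case=> [c|[c1 c2]|[c1 c2]]; [constructor 1|constructor 2|constructor 3];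
    by rewrite ?(connect_trans xz c) ?(connect_trans xz c1).
- by case=> [c|[c1 c2]|[c1 c2]]; [constructor 2|constructor 2|constructor 1].
- by case=> [c|[c1 c2]|[c1 c2]]; [constructor 3|constructor 1|constructor 3].
Qed.

Lemma connect_invariant (e e' : rel T) (A : pred T) x y :
  (forall u v, A u -> e u v -> A v && e' u v) -> A x -> connect e x y ->
  connect e' x y.
Proof.
move=> ee' + /connectP[p + ->] {y}; elim: p x => [|z p IHp] x //= Ax /andP[exz].
have /andP[Az e'xz] := ee' _ _ Ax exz.
by move=> /(IHp _ Az); apply: connect_trans; exact: connect1.
Qed.

Lemma path_crossing (e : rel T) (A : pred T) x p : path e x p -> A x ->
  ~~ A (last x p) ->
  exists l u v r, [/\ x :: p = l ++ u :: v :: r, A u, ~~ A v & e u v].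
Proof.
elim: p x => [|z p IHp] x /=; first by move=> _ ->.
move=> /andP[exz zp] Ax nA; have [Az|nAz] := boolP (A z).
  have [l [u [v [r [E Au nAv euv]]]]] := IHp z zp Az nA.
  by exists (x :: l), u, v, r; rewrite E.
by exists [::], x, z, p.
Qed.

End connectivity.

Section trees.
Context (p : nat).
Implicit Types (E : {set {set 'I_p}}) (x y : 'I_p).

Lemma adj_sym E : symmetric (adj E).
Proof. by move=> x y; rewrite /adj /= eq_sym finset.setUC. Qed.

Lemma connect_adj_sym E x y : connect (adj E) x y = connect (adj E) y x.
Proof. exact: (sym_connect_sym (@adj_sym E)). Qed.

Lemma eq_set2 (T : finType) (x y a b : T) : [set x; y]%SET = [set a; b]%SET ->
  (x = a /\ y = b) \/ (x = b /\ y = a).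
Proof.
move=> /setP eq2; move: (eq2 x) (eq2 y) (eq2 a) (eq2 b).
rewrite !finset.in_set2 !eqxx /= ?orbT.
by move=> /esym/orP[]/eqP ? /esym/orP[]/eqP ? /orP[]/eqP ? /orP[]/eqP ?; subst; auto.
Qed.

Lemma adj_delE E x y u v : adj (E :\ [set x; y]%SET) u v =
  adj E u v && ~~ ((u == x) && (v == y) || (u == y) && (v == x)).
Proof.
rewrite /adj /= finset.in_setD1 -andbA; congr (_ && _); rewrite andbC;
  congr (_ && ~~ _).
apply/eqP/orP => [/eq_set2[[-> ->]|[-> ->]]|[/andP[/eqP-> /eqP->]|/andP[/eqP->
  /eqP->]]].
- by left; rewrite !eqxx.
- by right; rewrite !eqxx.
- by [].
- by rewrite finset.setUC.
Qed.

Lemma adj_del_sub E e : subrel (adj (E :\ e)) (adj E).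
Proof. by move=> u v; rewrite /adj /= finset.in_setD1 => /and3P[-> _]. Qed.

Lemma path_cycle E x s :
  path (adj E) x s -> adj E (last x s) x -> cycle (adj E) (x :: s).
Proof. by move=> xs sx; rewrite /= rcons_path xs. Qed.

Lemma tree_bridge E x y : is_tree E -> adj E x y ->
  ~~ connect (adj (E :\ [set x; y]%SET)) x y.
Proof.
move=> [_ _ acyc] xy; apply/negP => /connectP[s].
case/shortenP => {}s xs us _ yE.
have xsE : path (adj E) x s by apply: sub_path xs; exact: adj_del_sub.
case: s => [|z [|w s]] in xs us yE xsE *.
- by rewrite yE /= /adj /= eqxx in xy.
- by move: xs; rewrite /= andbT yE /= adj_delE !eqxx andbF.
- have := acyc [:: x, z, w & s] isT us.
  by rewrite path_cycle// -yE adj_sym.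
Qed.

(** An edge of a cycle is bypassed by the rest of the cycle. Bridges are easier to follow than
    cycles when an edge is exchanged. *)
Lemma bridges_tree E : (forall e, e \in E -> #|e| = 2%N) ->
  (forall x y, connect (adj E) x y) ->
  (forall x y, adj E x y -> ~~ connect (adj (E :\ [set x; y]%SET)) x y) ->
  is_tree E.
Proof.
move=> card2 conn bridge; split => // -[|x [|y [|z s]]] //= _ /and4P[xs ys zs us].
apply/negP => /and3P[xy yz]; rewrite rcons_path => /andP[zsp lx].
have := bridge _ _ xy; rewrite connect_adj_sym => /negP; apply.
have lastE : last z s \in z :: s by exact: mem_last.
apply/connectP; exists (z :: rcons s x); last by rewrite /= last_rcons.
rewrite /= rcons_path !adj_delE yz lx /=.
move: xs; rewrite !inE !negb_or => /and3P[xy' xz xns].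
move: ys; rewrite !inE !negb_or => /andP[yz' yns].
have -> : (y == x) = false by rewrite eq_sym (negbTE xy').
rewrite (negbTE xy') /= (eq_sym z) (negbTE xz) andbF /=.
have -> : (last z s == y) = false.
  by apply/negP => /eqP ly; move: lastE; rewrite ly inE (negbTE yz') (negbTE yns).
rewrite andbF /= andbT.
apply: (sub_in_path (P := [pred u | u != x])) zsp => [u v|].
  rewrite !inE => ux vx uv; rewrite adj_delE uv (negbTE ux) (negbTE vx) /=.
  by rewrite andbF.
rewrite /= eq_sym xz; apply/allP => u us'; rewrite inE.
by apply/eqP => ux; rewrite -ux us' in xns.
Qed.

Lemma tree_triangle_free E x y z : is_tree E -> adj E x y -> adj E y z ->
  ~~ adj E x z.
Proof.
move=> [_ _ acyc] xy yz; apply/negP => xz.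
have us : uniq [:: x; y; z].
  move: xy yz xz; rewrite /adj /= !inE => /andP[xy _] /andP[yz _] /andP[xz _].
  by rewrite negb_or xy yz xz.
by have := acyc [:: x; y; z] isT us; rewrite /= xy yz adj_sym xz.
Qed.

Lemma path_avoid E x y z s : path (adj E) z s -> x \notin z :: s ->
  connect (adj (E :\ [set x; y]%SET)) z (last z s).
Proof.
move=> zs xns; apply/connectP; exists s => //.
apply: (sub_in_path (P := [pred u | u != x])) zs => [u v|].
  rewrite !inE => ux vx uv; rewrite adj_delE uv (negbTE ux) (negbTE vx) /=.
  by rewrite andbF.
by apply/allP => u us; rewrite inE; apply/eqP => ux; rewrite -ux us in xns.
Qed.

(** If the first steps differ, the rests of both paths avoid [x] and together connect the ends of
    the edge xy without using it. *)
Lemma tree_path_unique E x s t : is_tree E ->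
  path (adj E) x s -> uniq (x :: s) -> path (adj E) x t -> uniq (x :: t) ->
  last x s = last x t -> s = t.
Proof.
move=> Etree; elim: s x t => [|y s IHs] x [|z t] //=.
- by move=> _ _ _ /andP[xt _] xE; rewrite xE mem_last in xt.
- by move=> _ /andP[xs _] _ _ xE; rewrite -xE mem_last in xs.
move=> /andP[xy ys] /andP[xns us] /andP[xz zt] /andP[xnt ut] lE.
have [yz|yz] := eqVneq y z.
  by move: zt ut lE; rewrite -yz => zt ut lE; congr (_ :: _); exact: (IHs y).
have := tree_bridge Etree xy => /negP; case.
apply: (@connect_trans _ _ (last y s)); last first.
  by rewrite connect_adj_sym; exact: path_avoid.
rewrite lE; apply: (@connect_trans _ _ z); last exact: path_avoid.
apply: connect1; rewrite adj_delE xz eqxx /= eq_sym (negbTE yz) /=.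
by case: eqVneq => //= ?; apply/negP => /eqP zx; move: xz; rewrite zx /adj /= eqxx.
Qed.

End trees.

(** * Orientations of a tree *)

Section dags.
Context (p : nat).
Implicit Types (D A B G : dag p) (E : {set {set 'I_p}}).

Lemma arc_irr D x : arc D x x = false.
Proof.
apply/negP => xx; have /forallP/(_ x)/forallP/(_ x) := arcs_acyclic D.
by rewrite [(x, x) \in _]xx connect0.
Qed.

Lemma arc_asym D x y : arc D x y -> ~~ arc D y x.
Proof.
move=> xy; apply/negP => yx.
have /forallP/(_ x)/forallP/(_ y) := arcs_acyclic D.
by rewrite [(x, y) \in _]xy => /negP; apply; exact: connect1.
Qed.

Lemma adj_skeleton D x y : adj (skeleton D) x y = arc D x y || arc D y x.
Proof.
rewrite /adj /=; apply/andP/orP => [[xy /imsetP[[a b] ab]]|].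
  by move=> /eq_set2[] [-> ->]; [left|right].
move=> H; split.
  by apply/negP => /eqP xy; case: H; rewrite xy arc_irr.
case: H => H; apply/imsetP; first by exists (x, y).
by exists (y, x) => //; rewrite finset.setUC.
Qed.

Lemma arc_adj D x y : arc D x y -> adj (skeleton D) x y.
Proof. by rewrite adj_skeleton => ->. Qed.

Lemma arc_flip D x y : adj (skeleton D) x y -> arc D y x = ~~ arc D x y.
Proof.
rewrite adj_skeleton => /orP[] xy; first by rewrite xy (negbTE (arc_asym xy)).
by rewrite xy (arc_asym xy).
Qed.

Lemma eq_skeleton D E : (forall e, e \in E -> #|e| = 2%N) ->
  (forall x y, adj (skeleton D) x y = adj E x y) -> skeleton D = E.
Proof.
move=> card2 DE; apply/setP => e; apply/idP/idP => eD.
- have /imsetP[[a b] ab ->] := eD.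
  have : adj E a b by rewrite -DE arc_adj.
  by case/andP.
- have /eqP/cards2P[a [b [ab eE]]] := card2 e eD.
  have : adj (skeleton D) a b by rewrite DE /adj /= ab -eE.
  by case/andP => _; rewrite -eE.
Qed.

Lemma eq_dag D A : (forall x y, arc D x y = arc A x y) -> D = A.
Proof. by move=> DA; apply/val_inj/setP => -[x y]; exact: DA. Qed.

(** A directed cycle would be an undirected one, of length at least three because [g] never holds
    both ways. *)
Lemma orient_tree E (g : rel 'I_p) : is_tree E ->
  (forall x y, g x y -> adj E x y) ->
  (forall x y, adj E x y -> g y x = ~~ g x y) ->
  exists G, skeleton G = E /\ forall x y, arc G x y = g x y.
Proof.
move=> Etree gE gflip; pose s := [set a | g a.1 a.2]%SET.
have sg x y : ((x, y) \in s) = g x y by rewrite finset.inE.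
have s_acyclic : acyclic s.
  apply/forallP => x; apply/forallP => y; apply/implyP; rewrite sg => xy.
  apply/negP => /connectP[t]; case/shortenP => {}t yt ut _ xE.
  have ytE : path (adj E) y t.
    by apply: sub_path yt => u v; rewrite /= sg; exact: gE.
  have [_ _ acyc] := Etree.
  case: t => [|z [|w t]] in yt ut xE ytE *.
  - by have := gE _ _ xy; rewrite xE /adj /= eqxx.
  - by move: yt; rewrite /= andbT sg -[z]xE gflip ?xy// gE.
  - by have := acyc [:: y, z, w & t] isT ut; rewrite path_cycle// -xE gE.
exists (Dag s_acyclic);
  have arcE x y : arc (Dag s_acyclic) x y = g x y by rewrite /arc /= sg.
split => //; apply: eq_skeleton; first by case: Etree.
move=> x y; rewrite adj_skeleton !arcE; apply/orP/idP => [[/gE//|/gE]|xy].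
  by rewrite adj_sym.
by rewrite (gflip _ _ xy); case: (g x y); [left|right].
Qed.

(** The head of an arc decides from which DAG it is taken, so every vertex keeps a whole parent set
    of [A] or of [B], as decomposability requires. Agreement on the edges leaving [U] makes the
    choice consistent. *)
Lemma glue_dags E (U : pred 'I_p) A B : is_tree E -> skeleton A = E ->
  skeleton B = E ->
  (forall x y, U x -> ~~ U y -> adj E x y -> arc A x y = arc B x y) ->
  exists G, skeleton G = E /\
    forall x y, arc G x y = if U y then arc A x y else arc B x y.
Proof.
move=> Etree AE BE AB; apply: orient_tree => // x y.
- by case: ifPn => _ /arc_adj; rewrite ?AE ?BE.
- move=> xy; have yx : adj E y x by rewrite adj_sym.
  have fA : arc A y x = ~~ arc A x y by rewrite (@arc_flip A x y)// AE.
  have fB : arc B y x = ~~ arc B x y by rewrite (@arc_flip B x y)// BE.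
  case: ifPn => Ux; case: ifPn => Uy //.
  + by rewrite fA AB.
  + by rewrite -(AB y x)// fA.
Qed.

(* The part of the parent set of [i] visible in the characteristic imset on
   the sets of at least three vertices. *)
Definition collider_parents D i : {set 'I_p} :=
  if (1 < #|parents D i|)%N then parents D i else finset.set0.

Definition differing D A : {set 'I_p} :=
  [set i | collider_parents D i != collider_parents A i]%SET.

Lemma in_parents D i k : (k \in parents D i) = arc D k i.
Proof. by rewrite finset.inE. Qed.

Lemma markov_equiv_refl D : markov_equiv D D.
Proof. by rewrite /markov_equiv eqxx; do 3![apply/forallP => ?]. Qed.

Lemma markov_equiv_sym D A : markov_equiv D A = markov_equiv A D.
Proof.
rewrite /markov_equiv eq_sym; congr (_ && _).
by do 3![apply: eq_forallb => ?]; rewrite eq_sym.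
Qed.

(** Two parents of a vertex of a tree are not adjacent, so a parent that is not alone belongs to a
    v-structure. *)
Lemma markov_equiv_parents E D A i : is_tree E -> skeleton D = E ->
  markov_equiv D A -> (1 < #|parents D i|)%N -> parents D i \subset parents A i.
Proof.
move=> Etree DE /andP[_ vDA] Pi; apply/fintype.subsetP => a aPi.
have [b bPi ab] : exists2 b, b \in parents D i & a != b.
  have /card_gt0P[b] : (0 < #|parents D i :\ a|)%N.
    by move: Pi; rewrite (cardsD1 a) aPi.
  by rewrite finset.in_setD1 => /andP[ba bPi]; exists b => //; rewrite eq_sym.
have [aa bb] : arc D a i /\ arc D b i by rewrite -!in_parents.
have va : v_structure D a i b.
  rewrite /v_structure ab aa bb /= DE; apply: (tree_triangle_free (y := i)) => //.
    by rewrite -DE arc_adj.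
  by rewrite adj_sym -DE arc_adj.
have /forallP/(_ a)/forallP/(_ i)/forallP/(_ b)/eqP := vDA.
by rewrite va => /esym/and4P[_ ai _ _]; rewrite in_parents.
Qed.

Lemma markov_equiv_collider_parents E D A i : is_tree E -> skeleton D = E ->
  markov_equiv D A -> collider_parents D i = collider_parents A i.
Proof.
move=> Etree DE DA; have AE : skeleton A = E by have /andP[/eqP <-] := DA.
have AD : markov_equiv A D by rewrite markov_equiv_sym.
rewrite /collider_parents; case: ifPn => Di; case: ifPn => Ai //.
- by apply/eqP; rewrite finset.eqEsubset !(@markov_equiv_parents E).
- by case/negP: Ai; apply: (leq_trans Di (subset_leq_card _));
  exact: (@markov_equiv_parents E).
- by case/negP: Di; apply: (leq_trans Ai (subset_leq_card _));
  exact: (@markov_equiv_parents E).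
Qed.

(** A center [k] other than [i] would close a triangle with [i] and a third vertex [l] of [S]. *)
Lemma imset_vec_center E D i (S : {set 'I_p}) : is_tree E -> skeleton D = E ->
  S \in nbhd_sets E i -> imset_vec D S = (S :\ i \subset collider_parents D i).
Proof.
move=> Etree DE; rewrite finset.inE => /and3P[iS Snb S3].
have cardSi : (1 < #|S :\ i|)%N by move: S3; rewrite (cardsD1 i) iS.
have -> : (S :\ i \subset collider_parents D i) = (S :\ i \subset parents D i).
  rewrite /collider_parents; case: ifPn => // Pi.
  rewrite finset.subset0; apply/idP/idP => [/eqP S0|/subset_leq_card le].
    by rewrite S0 cards0 in cardSi.
  by case/negP: Pi; exact: leq_trans le.
apply/existsP/idP => [[k /andP[kS Sk]]|Si]; last by exists i; rewrite iS.
have [<-//|ki] := eqVneq k i.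
have /card_gt0P[l] : (0 < #|S :\ i :\ k|)%N.
  by move: cardSi; rewrite (cardsD1 k) finset.in_setD1 ki kS.
rewrite !finset.in_setD1 => /and3P[lk li lS].
have iadj u : u \in S -> u != i -> adj E i u.
  move=> uS ui; have := fintype.subsetP Snb u uS.
  by rewrite finset.in_setU1 (negbTE ui) finset.inE.
have lk' : adj E l k.
  by rewrite -DE arc_adj// -in_parents (fintype.subsetP Sk)// finset.in_setD1 lk.
have := tree_triangle_free Etree (iadj l lS li) lk'.
by rewrite iadj.
Qed.

Lemma flip_support_sub E D A : is_tree E -> skeleton D = E -> skeleton A = E ->
  flip_support A D \subset differing D A.
Proof.
move=> Etree DE AE; apply/fintype.subsetP => i; rewrite !finset.inE AE.
move=> /existsP[S /andP[Si]]; rewrite !(@imset_vec_center E _ i)//.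
by apply: contra => /eqP ->.
Qed.

Lemma not_essential E D i j : is_tree E -> skeleton D = E -> arc D i j ->
  ~~ essential_arc D i j -> exists2 A, markov_equiv D A & arc A j i.
Proof.
move=> Etree DE ij /forallPn[A]; rewrite negb_imply => /andP[DA nA].
exists A => //; rewrite arc_flip//; have /andP[/eqP <- _] := DA.
by rewrite arc_adj.
Qed.

End dags.

(** * The search has no spurious local maximum *)

Section search.
Context (R : realType) (p : nat).
Implicit Types (D A B G : dag p).
Variables (E : {set {set 'I_p}}) (Etree : is_tree E).

(** Were there no such vertex, the part of [S] on the side of [i] would be a smaller subtree
    containing [Delta]. *)
Lemma span_meets_side (Delta S : {set 'I_p}) i j : is_span E Delta S ->
  i \in S -> j \in S -> adj E i j ->
  exists2 d, d \in Delta & connect (adj (E :\ [set i; j]%SET)) j d.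
Proof.
move=> /minsetP[/andP[/andP[_ Sconn] DeltaS] Smin] iS jS ij.
have [/exists_inP[d dD jd]|none] :=
  boolP [exists d in Delta, connect (adj (E :\ [set i; j]%SET)) j d].
  by exists d.
pose S' := [set z in S | ~~ connect (adj (E :\ [set i; j]%SET)) j z]%SET.
have S'S : S' \subset S by apply/fintype.subsetP => z; rewrite finset.inE => /andP[].
have bridge := tree_bridge Etree ij.
have iS' : i \in S' by rewrite finset.inE iS connect_adj_sym.
suff : j \in S' by rewrite finset.inE connect0 andbF.
rewrite (Smin S')//; apply/andP; split; last first.
  apply/fintype.subsetP => d dD; rewrite finset.inE (fintype.subsetP DeltaS)//=.
  by apply: contra none => jd; apply/exists_inP; exists d.
apply/andP; split; first by apply/set0Pn; exists i.
apply/forall_inP => x xS'; apply/forall_inP => y yS'.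
have [xS nx] : x \in S /\ ~~ connect (adj (E :\ [set i; j]%SET)) j x.
  by move: xS'; rewrite finset.inE => /andP.
have [yS ny] : y \in S /\ ~~ connect (adj (E :\ [set i; j]%SET)) j y.
  by move: yS'; rewrite finset.inE => /andP.
pose e := [rel u v | [&& adj (E :\ [set i; j]%SET) u v, u \in S & v \in S]].
have eE u v : connect e u v -> connect (adj (E :\ [set i; j]%SET)) u v.
  by apply: connect_sub => a b /and3P[ab _ _]; exact: connect1.
have : connect e x y.
  have : connect [rel u v | [|| e u v, (u == i) && (v == j) | (u == j) && (v ==
    i)]] x y.
    have /forall_inP/(_ x xS)/forall_inP/(_ y yS) := Sconn.
    apply: connect_sub => u v /and3P[uv uS vS]; apply: connect1.
    by rewrite /= adj_delE uv uS vS /= !andbT orNb.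
  case/connect_add_edge => // -[c1 c2].
    by rewrite eE in ny.
  by move: nx; rewrite connect_adj_sym eE.
apply: (@connect_invariant _ _ _ (fun z => z \in S')) => // u v uS'.
move=> /and3P[uv uS vS].
have vS' : v \in S'.
  rewrite finset.inE vS; move: uS'; rewrite finset.inE uS /=; apply: contra => jv.
  by apply: connect_trans jv _; rewrite connect_adj_sym; exact: connect1.
by rewrite vS' /= (adj_del_sub uv) uS' vS'.
Qed.

Variable sc : dag p -> R.
Hypothesis sc_equiv : forall D A, markov_equiv D A -> sc D = sc A.
Hypothesis sc_decomp : exists s : 'I_p -> {set 'I_p} -> R,
  forall D, sc D = \sum_(i < p) s i (parents D i).

Lemma score_glue U A B G G' :
  (forall x y, arc G x y = if U y then arc A x y else arc B x y) ->
  (forall x y, arc G' x y = if U y then arc B x y else arc A x y) ->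
  sc G + sc G' = sc A + sc B.
Proof.
move=> GE G'E; case: sc_decomp => s scE; rewrite !scE -!big_split /=.
apply: eq_bigr => i _.
have pE D1 D2 : (forall x, arc D1 x i = arc D2 x i) -> parents D1 i = parents D2 i.
  by move=> D12; apply/setP => k; rewrite !in_parents.
case Ui : (U i).
  by rewrite (pE G A) ?(pE G' B)// => x; rewrite ?GE ?G'E Ui.
by rewrite addrC (pE G B) ?(pE G' A)// => x; rewrite ?GE ?G'E Ui.
Qed.

(* When the edge ij of the span is oriented alike in two dags equivalent to [A]
   and [D], gluing these dags along the edge splits the change of score from
   [D] to [A] into two changes supported on either side of it. *)
Lemma split_difference D A D' A' S i j : skeleton D = E -> skeleton A = E ->
  is_span E (flip_support A D) S -> i \in S -> j \in S -> adj E i j ->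
  sc D < sc A -> markov_equiv D D' -> markov_equiv A A' -> arc A' i j = arc D' i j ->
  exists G, [/\ skeleton G = E, sc D < sc G &
    (#|differing D G| < #|differing D A|)%N].
Proof.
move=> DE AE Sspan iS jS ij DA DD' AA' AD'ij.
have D'E : skeleton D' = E by have /andP[/eqP <- _] := DD'.
have A'E : skeleton A' = E by have /andP[/eqP <- _] := AA'.
have ji : adj E j i by rewrite adj_sym.
pose U z := connect (adj (E :\ [set i; j]%SET)) j z.
have bridge := tree_bridge Etree ij.
(* The bridge ij is the only edge between the two sides, so agreement on it is all that gluing
   needs. *)
have crossing x y : U x -> ~~ U y -> adj E x y -> arc A' x y = arc D' x y.
  move=> Ux nUy xy; have [/andP[/eqP -> /eqP ->]|xyij] :=
    boolP ((x == j) && (y == i)).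
    by rewrite (@arc_flip _ A' i j) ?A'E// (@arc_flip _ D' i j) ?D'E// AD'ij.
  have [/andP[/eqP xi _]|xyji] := boolP ((x == i) && (y == j)).
    by move: Ux bridge; rewrite xi /U connect_adj_sym => ->.
  case/negP: nUy; apply: connect_trans Ux _; apply: connect1.
  by rewrite adj_delE xy (negbTE xyij) (negbTE xyji).
have crossing' x y : U x -> ~~ U y -> adj E x y -> arc D' x y = arc A' x y.
  by move=> Ux Uy xy; rewrite crossing.
have [G1 [G1E G1arc]] := glue_dags Etree A'E D'E crossing.
have [G2 [G2E G2arc]] := glue_dags Etree D'E A'E crossing'.
(* The support has a vertex on each side of the edge. The one on the side copied from [D'] stops
   differing, which makes the decrease strict. *)
have [d dS jd] := span_meets_side Sspan iS jS ij.
have [d' d'S id'] : exists2 d', d' \in flip_support A D & ~~ U d'.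
  have [d' d'S id'] := span_meets_side Sspan jS iS ji; exists d' => //.
  apply: contra bridge => jd'; apply: connect_trans (_ : connect _ d' _).
    by move: id'; rewrite finset.setUC.
  by rewrite connect_adj_sym.
have dsub := fintype.subsetP (flip_support_sub Etree DE AE).
have cD z : collider_parents D' z = collider_parents D z.
  by rewrite (markov_equiv_collider_parents z Etree DE DD').
have cA z : collider_parents A' z = collider_parents A z.
  by rewrite (markov_equiv_collider_parents z Etree AE AA').
have cE (F F' : dag p) z : (forall x, arc F x z = arc F' x z) ->
    collider_parents F z = collider_parents F' z.
  move=> FF'; rewrite /collider_parents (_ : parents F z = parents F' z)//.
  by apply/setP => k; rewrite !in_parents.
have diff1 z : z \in differing D G1 -> (z \in differing D A) && U z.
  rewrite !finset.inE; case Uz : (U z).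
    by rewrite (cE G1 A') ?cA ?andbT// => x; rewrite G1arc Uz.
  by rewrite (cE G1 D') ?cD ?eqxx// => x; rewrite G1arc Uz.
have diff2 z : z \in differing D G2 -> (z \in differing D A) && ~~ U z.
  rewrite !finset.inE; case Uz : (U z).
    by rewrite (cE G2 D') ?cD ?eqxx// => x; rewrite G2arc Uz.
  by rewrite (cE G2 A') ?cA ?andbT// => x; rewrite G2arc Uz.
have sc12 := score_glue G1arc G2arc.
rewrite -(sc_equiv DD') -(sc_equiv AA') in sc12.
have [DG1|G1D] := ltP (sc D) (sc G1).
  exists G1; split => //; apply: proper_card; apply/properP; split.
    by apply/fintype.subsetP => z /diff1/andP[].
  by exists d'; [exact: dsub|apply: contra id' => /diff1/andP[]].
exists G2; split => //; first by move: DA sc12 G1D; lra.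
apply: proper_card; apply/properP; split.
  by apply/fintype.subsetP => z /diff2/andP[].
by exists d; [exact: dsub|apply/negP => /diff2/andP[_ /negP]; apply].
Qed.

(** An edge of the span that is not essentially reversed either has the same direction in [D] and
    [A], or has a direction that is not essential in one of them; an equivalent DAG then makes the
    directions agree, and [split_difference] applies. *)
Lemma flip_or_split D A : skeleton D = E -> skeleton A = E -> sc D < sc A ->
  essential_flip A D \/
  exists G, [/\ skeleton G = E, sc D < sc G &
    (#|differing D G| < #|differing D A|)%N].
Proof.
move=> DE AE DA.
have nAD : ~~ markov_equiv A D.
  by apply/negP => /sc_equiv AD; rewrite AD ltxx in DA.
have setT_ok : [pred V | subtree E V && (flip_support A D \subset V)] [set: 'I_p]%SET.
  rewrite /= finset.subsetT andbT; apply/andP; split.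
    (* Without vertices there is no nonempty subtree, but then all DAGs are equivalent. *)
    apply/set0Pn; have [x|noI] := pickP 'I_p; first by exists x;
      rewrite finset.in_setT.
    case/negP: nAD; rewrite /markov_equiv AE DE eqxx.
    by apply/forallP => x; have := noI x.
  apply/forall_inP => x _; apply/forall_inP => y _.
  have [_ /(_ x y) xy _] := Etree; apply: connect_sub xy => u v uv.
  by apply: connect1; rewrite /= uv !finset.in_setT.
have [S Sspan _] := minset_exists setT_ok.
pose flipped i j := essential_arc A i j && essential_arc D j i
          || essential_arc A j i && essential_arc D i j.
have [/forall_inP flips|] := boolP [forall i in S, forall j in S, adj E i j ==>
  flipped i j].
  left; split; rewrite ?AE ?DE//; exists S => // i j iS jS ij.
  by have /forall_inP/(_ j jS)/implyP := flips i iS; exact.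
move=> /forall_inPn[i iS /forall_inPn[j jS]]; rewrite negb_imply => /andP[ij nflip].
right; have split_ij D' A' := @split_difference D A D' A' S i j DE AE Sspan iS jS
  ij DA.
have refl := @markov_equiv_refl p.
have ji : adj E j i by rewrite adj_sym.
have fl F : skeleton F = E -> arc F j i = ~~ arc F i j by move=> FE;
  rewrite (@arc_flip _ F i j) ?FE.
have skE F F' : skeleton F = E -> markov_equiv F F' -> skeleton F' = E.
  by move=> <- /andP[/eqP -> _].
have [same|] := eqVneq (arc A i j) (arc D i j); first exact: (split_ij D A).
move: nflip; rewrite /flipped negb_or !negb_and.
case Aij : (arc A i j); case Dij : (arc D i j) => // /andP[n1 n2] _.
- have Dji : arc D j i by rewrite fl ?Dij.
  case/orP: n1 => n1.
    have [A' AA' A'ji] := not_essential Etree AE Aij n1.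
    apply: (split_ij D A') => //; rewrite Dij.
    by apply/negbTE; rewrite -(fl _ (skE _ _ AE AA')).
  have [D' DD' D'ij] := not_essential Etree DE Dji n1.
  by apply: (split_ij D' A) => //; rewrite Aij D'ij.
- have Aji : arc A j i by rewrite fl ?Aij.
  case/orP: n2 => n2.
    have [A' AA' A'ij] := not_essential Etree AE Aji n2.
    by apply: (split_ij D A') => //; rewrite Dij A'ij.
  have [D' DD' D'ji] := not_essential Etree DE Dij n2.
  apply: (split_ij D' A) => //; rewrite Aij; apply/esym/negbTE.
  by rewrite -(fl _ (skE _ _ DE DD')).
Qed.

(* Reversing one connected component of the set of differing edges, or all the
   others: the changes of score add up. *)
Lemma reverse_component D A : skeleton D = E -> skeleton A = E -> sc D < sc A ->
  (exists G, [/\ skeleton G = E, sc D < sc G,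
     differing D G \subset differing D A & arcs D :\: arcs G \proper arcs D :\:
       arcs A]) \/
  exists G, exists2 C, subtree E C & [/\ skeleton G = E, sc D < sc G,
     differing D G \subset differing D A & arcs G = reverse_in C D].
Proof.
move=> DE AE DA.
have [[x y] /= xyD xyA] : exists2 a, a \in arcs D & a \notin arcs A.
  apply/fintype.subsetPn; apply/negP => /fintype.subsetP DsubA.
  suff DA' : D = A by rewrite DA' ltxx in DA.
  apply: eq_dag => u v; apply/idP/idP => [|uv]; first exact: DsubA.
  have uvE : adj E u v by rewrite -AE arc_adj.
  apply/negPn; rewrite -(@arc_flip _ D u v) ?DE//; apply/negP => vu.
  by have := DsubA _ vu; rewrite -[_ \in _]/(arc A v u) (negbTE (arc_asym uv)).
(* [e] joins the ends of the edges that [D] and [A] orient oppositely. They agree on the edges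
   leaving the component [C] of [x], so they can be glued along it. *)
pose e := [rel u v | arc D u v && arc A v u || arc D v u && arc A u v].
have e_sym : symmetric e by move=> u v; rewrite /e /= orbC.
pose C := [set z | connect e x z]%SET.
have eE : subrel e (adj E).
  by move=> u v /orP[] /andP[/arc_adj uv _]; rewrite -DE// adj_sym.
have crossing u v : u \in C -> v \notin C -> adj E u v -> arc D u v = arc A u v.
  rewrite !finset.inE => xu nxv uv; have [//|DAuv] := eqVneq (arc D u v) (arc A u v).
  case/negP: nxv; apply: connect_trans xu _; apply: connect1.
  move: DAuv; rewrite /e /= (@arc_flip _ D u v) ?DE// (@arc_flip _ A u v) ?AE//.
  by case: (arc D u v); case: (arc A u v).
have crossing' u v : u \in C -> v \notin C -> adj E u v -> arc A u v = arc D u v.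
  by move=> uC vC uv; rewrite crossing.
have [G1 [G1E G1arc]] := glue_dags (U := fun z => z \in C) Etree AE DE crossing'.
have [G2 [G2E G2arc]] := glue_dags (U := fun z => z \in C) Etree DE AE crossing.
have sc12 := score_glue G1arc G2arc.
have diff G : (forall z, (forall u, arc G u z = arc D u z) \/
      (forall u, arc G u z = arc A u z)) -> differing D G \subset differing D A.
  move=> GDA; apply/fintype.subsetP => z; rewrite !finset.inE.
  have cE F : (forall u, arc G u z = arc F u z) -> collider_parents G z =
    collider_parents F z.
    move=> GF; rewrite /collider_parents (_ : parents G z = parents F z)//.
    by apply/setP => k; rewrite !in_parents.
  by case: (GDA z) => /cE ->; rewrite ?eqxx.
have [DG2|G2D] := ltP (sc D) (sc G2).
  left; exists G2; split => //.
    by apply: diff => z; case zC : (z \in C); [left|right] => u; rewrite G2arc zC.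
  apply/properP; split.
    apply/fintype.subsetP => -[u v]; rewrite !finset.in_setD.
    rewrite -[(u, v) \in arcs G2]/(arc G2 u v) G2arc.
    by case: ifP => // _; rewrite -[(u, v) \in arcs D]/(arc D u v) andNb.
  exists (x, y); first by rewrite finset.in_setD xyD xyA.
  rewrite finset.in_setD -[(x, y) \in arcs G2]/(arc G2 x y) G2arc.
  have -> : y \in C.
    rewrite finset.inE; apply: connect1; rewrite /e /= [arc D x y]xyD /=.
    by rewrite (@arc_flip _ A x y) ?xyA// AE -DE arc_adj.
  by rewrite [arc D x y]xyD.
right; exists G1, C; last split => //.
- have eC u v : u \in C -> v \in C ->
      connect [rel a b | [&& adj E a b, a \in C & b \in C]] u v.
    move=> uC vC; have uv : connect e u v.
      move: uC vC; rewrite !finset.inE (sym_connect_sym e_sym x u).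
      exact: connect_trans.
    apply: (@connect_invariant _ _ _ (fun z => z \in C) _ _ _ uC uv) => a b aC ab.
    have bC : b \in C.
      by move: aC; rewrite !finset.inE => xa; exact: connect_trans xa (connect1 ab).
    by rewrite bC /= (eE _ _ ab) aC bC.
  apply/andP; split; first by apply/set0Pn; exists x; rewrite finset.inE connect0.
  by apply/forall_inP => u uC; apply/forall_inP => v vC; exact: eC.
- by move: DA sc12 G2D; lra.
- by apply: diff => z; case zC : (z \in C); [right|left] => u; rewrite G1arc zC.
(* An edge inside the component is reversed, since the tree has no other
   connection between its ends. *)
have reversed u v : u \in C -> v \in C -> adj E u v -> arc D u v != arc A u v.
  move=> uC vC uv; apply/negP => /eqP DAuv.
  have := tree_bridge Etree uv => /negP; apply.
  have : connect e u v.
    move: uC vC; rewrite !finset.inE (sym_connect_sym e_sym x u).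
    exact: connect_trans.
  apply: connect_sub => a b ab; apply: connect1.
  rewrite adj_delE (eE _ _ ab) /=; apply/negP.
  have DAvu : arc D v u = arc A v u.
    by rewrite (@arc_flip _ D u v) ?DE// (@arc_flip _ A u v) ?AE// DAuv.
  move: ab; rewrite /e /= => /[swap] /orP[] /andP[/eqP -> /eqP ->];
    rewrite DAuv DAvu => /orP[] /andP[uv' vu'];
    by move: (arc_asym uv'); rewrite vu'.
apply/setP => -[u v]; rewrite finset.inE /= -[(u, v) \in arcs G1]/(arc G1 u v) G1arc.
rewrite -[(v, u) \in arcs D]/(arc D v u) -[(u, v) \in arcs D]/(arc D u v).
case vC : (v \in C); rewrite ?andbF// andbT; case uC : (u \in C).
- have [uv|nuv] := boolP (adj E u v).
    rewrite (@arc_flip _ D u v) ?DE//; have := reversed _ _ uC vC uv.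
    by case: (arc D u v); case: (arc A u v).
  have nA : ~~ arc A u v by apply: contra nuv => /arc_adj; rewrite AE.
  have nD : ~~ arc D v u by apply: contra nuv => /arc_adj; rewrite DE adj_sym.
  by rewrite (negbTE nA) (negbTE nD).
- have [uv|nuv] := boolP (adj E u v).
    have vu : adj E v u by rewrite adj_sym.
    rewrite (@arc_flip _ A v u) ?AE// (@arc_flip _ D v u) ?DE//.
    by rewrite crossing// uC.
  have [nA nD] : ~~ arc A u v /\ ~~ arc D u v.
    by split; apply: contra nuv => /arc_adj; rewrite ?AE ?DE.
  by rewrite (negbTE nA) (negbTE nD).
Qed.

(** Induction on [A], with [D] fixed. As [N] exceeds any number of arcs, the measure is
    lexicographic: [reverse_component] lowers the number of differing arcs and adds no differing
    vertex, while [flip_or_split] lowers the number of differing vertices without control on the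
    arcs. *)
Lemma improving_candidate D A : skeleton D = E -> skeleton A = E -> sc D < sc A ->
  exists2 G, eft_candidate E D G & sc D < sc G.
Proof.
move=> DE; pose N := #|{: 'I_p * 'I_p}|.+1.
have [n] := ubnP (#|differing D A| * N + #|arcs D :\: arcs A|).
elim: n A => // n IHn A le_n AE DA.
have small (F : dag p) : (#|arcs D :\: arcs F| < N)%N by rewrite ltnS max_card.
case: (reverse_component DE AE DA) => [[G [GE DG diffG arcsG]]|].
  apply: (IHn G) => //; rewrite ltnS in le_n; apply: leq_trans le_n.
  by rewrite -addnS leq_add ?leq_mul2r ?subset_leq_card ?orbT ?proper_card.
move=> [G [C Ctree [GE DG diffG arcsG]]].
case: (flip_or_split DE GE DG) => [flip|[F [FE DF diffF]]].
  by exists G => //; exists C.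
apply: (IHn F) => //; rewrite ltnS in le_n; apply: leq_trans le_n.
apply: (@leq_trans (#|differing D F|.+1 * N)).
  by rewrite mulSn -addnS addnC leq_add2r small.
by rewrite (leq_trans _ (leq_addr _ _))// leq_mul2r (leq_trans diffF)
  ?subset_leq_card ?orbT.
Qed.

End search.

(** * Separation and information along a path *)

Lemma uniq_last_neq (T : eqType) (i a b : T) s l r : uniq (i :: s) ->
  i :: s = l ++ [:: a, b & r] -> i != last i s.
Proof.
move=> us sE; have sn0 : s != [::].
  by apply/eqP => s0; move: (congr1 size sE); rewrite s0 size_cat /=; lia.
have js : last i s \in s by case: (s) sn0 => //= x s' _; exact: mem_last.
by apply/eqP => ij; move: us; rewrite /= {1}ij js.
Qed.

Section d_separation.
Context (p : nat).
Implicit Types (D H : dag p) (C : {set 'I_p}) (E : {set {set 'I_p}}).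

Lemma active_trailP D C x s : reflect
  (forall l u v w r, x :: s = l ++ [:: u, v, w & r] -> unblocked D C u v w)
  (active_trail D C x s).
Proof.
elim: s x => [|y [|z s] IHs] x /=.
- by apply: (iffP idP) => // _ [|? [|? l]] u v w r.
- by apply: (iffP idP) => // _ [|? [|? [|? l]]] u v w r.
apply: (iffP andP) => [[xyz /IHs act] [|a l] u v w r|act].
- by case=> <- <- <- _.
- by case=> _ /act.
- split; first exact: (act [::] x y z s).
  by apply/IHs => l u v w r E; apply: (act (x :: l)); rewrite E.
Qed.

Lemma unblocked0 D u v w :
  unblocked D finset.set0 u v w = ~~ (arc D u v && arc D w v).
Proof.
rewrite /unblocked; case: ifPn => _; last by rewrite finset.in_set0.
by apply/existsP => -[c]; rewrite finset.in_set0.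
Qed.

Lemma unblocked_noncollider D C u v w : ~~ (arc D u v && arc D w v) ->
  unblocked D C u v w = (v \notin C).
Proof. by rewrite /unblocked => /negbTE ->. Qed.

(** Conditioning on the middle vertex opens a collider, which is its own descendant, and closes any
    other vertex. *)
Lemma unblocked1 D u v w : unblocked D [set v]%SET u v w = arc D u v && arc D w v.
Proof.
have [c|nc] := boolP (arc D u v && arc D w v).
  by rewrite /unblocked c; apply/existsP; exists v; rewrite finset.set11 connect0.
by rewrite unblocked_noncollider// finset.set11.
Qed.

Lemma unblocked_sym D C u v w : unblocked D C u v w = unblocked D C w v u.
Proof. by rewrite /unblocked andbC. Qed.

Lemma tree_d_separatedP E D C i s : is_tree E -> skeleton D = E ->
  path (adj E) i s -> uniq (i :: s) ->
  d_separated D [set i]%SET [set last i s]%SET C <-> ~~ active_trail D C i s.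
Proof.
move=> Etree DE ps us; split=> [dsep|nact].
  by apply: (dsep i (last i s)); rewrite ?finset.set11 ?DE.
move=> a b t /finset.set1P -> /finset.set1P -> pt ut tE.
by rewrite -(tree_path_unique Etree ps us _ ut) ?tE// -DE.
Qed.

(** On a path i - j - k the ends are separated by the empty set exactly when j is a collider, and by
    j exactly when it is not. Whichever holds in [D] passes to [H]. *)
Lemma d_separated_markov_equiv E D H : is_tree E -> skeleton D = E ->
  skeleton H = E ->
  (forall A B C, disjoint3 A B C -> d_separated D A B C -> d_separated H A B C) ->
  markov_equiv D H.
Proof.
move=> Etree DE HE DH.
have collider i j k : i != k -> adj E i j -> adj E j k ->
    arc D i j && arc D k j = arc H i j && arc H k j.
  move=> ik ij jk; have [ij' jk'] : i != j /\ j != k.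
    by split; [case/andP: ij|case/andP: jk].
  have ps : path (adj E) i [:: j; k] by rewrite /= ij jk.
  have us : uniq [:: i; j; k] by rewrite /= !inE negb_or ij' ik jk'.
  have sepP F C : skeleton F = E ->
      d_separated F [set i]%SET [set k]%SET C <-> ~~ unblocked F C i j k.
    by move=> FE; have := @tree_d_separatedP E F C i _ Etree FE ps us;
      rewrite /= andbT.
  have disj C : C \subset [set j]%SET -> disjoint3 [set i]%SET [set k]%SET C.
    move=> Cj; rewrite /disjoint3 !disjoints1 finset.in_set1 ik /=.
    apply/andP; split; apply/negP => /(fintype.subsetP Cj); rewrite finset.in_set1.
      by rewrite (negbTE ij').
    by rewrite eq_sym (negbTE jk').
  case cD : (arc D i j && arc D k j).
    have := DH _ _ _ (disj finset.set0 (finset.sub0set _)).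
    by rewrite !sepP// !unblocked0 cD => /(_ isT) /negPn ->.
  have := DH _ _ _ (disj [set j]%SET (subxx _)).
  by rewrite !sepP// !unblocked1 cD => /(_ isT) /negbTE ->.
rewrite /markov_equiv DE HE eqxx; apply/forallP => i; apply/forallP => j.
apply/forallP => k; apply/eqP; rewrite /v_structure DE HE.
have [//|ik] := eqVneq i k.
have [ij|nij] := boolP (adj E i j); last first.
  have /negbTE -> : ~~ arc D i j by apply: contra nij; rewrite -DE; exact: arc_adj.
  have /negbTE -> : ~~ arc H i j by apply: contra nij; rewrite -HE; exact: arc_adj.
  by rewrite !andbF.
have [kj|nkj] := boolP (adj E k j); last first.
  have /negbTE -> : ~~ arc D k j by apply: contra nkj; rewrite -DE; exact: arc_adj.
  have /negbTE -> : ~~ arc H k j by apply: contra nkj; rewrite -HE; exact: arc_adj.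
  by rewrite !andbF.
by rewrite !andbA /= (collider i j k)// adj_sym.
Qed.

End d_separation.

Section tree_information.
Context (R : realType) (p : nat) (E : {set {set 'I_p}}) (H : dag p).
Hypotheses (Etree : is_tree E) (HE : skeleton H = E).
Variable v : 'I_p -> 'I_p -> R.
Hypothesis v_sym : forall i j, i != j -> v i j = v j i.
Hypothesis v_lt : forall i j k, i != j -> i != k -> j != k ->
  d_separated H [set i]%SET [set j]%SET [set k]%SET ->
  ~ d_separated H [set k]%SET [set j]%SET [set i]%SET -> v i j < v k j.
Hypothesis v_eq0 : forall i j, i != j ->
  d_separated H [set i]%SET [set j]%SET finset.set0 -> v i j = 0.
Hypothesis v_gt0 : forall i j, i != j ->
  ~ d_separated H [set i]%SET [set j]%SET finset.set0 -> 0 < v i j.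

(** A trail active given the empty set has no collider. Its inner vertex [k] therefore blocks it,
    while the piece from [k] on avoids [i] and stays active given [i]. *)
Let active_lt i s1 k x s2 : let s := s1 ++ [:: k, x & s2] in
  path (adj E) i s -> uniq (i :: s) -> active_trail H finset.set0 i s ->
  v i (last i s) < v k (last i s).
Proof.
move=> s ps us act; set j := last i s.
have sE : j = last x s2 by rewrite /j /s last_cat.
have [ik jk ij] : [/\ i != k, j != k & i != j].
  move: us; rewrite sE /= /s mem_cat !inE !negb_or cat_uniq /= inE.
  move=> /andP[/and4P[_ ik ix is2] /and5P[_ _ + _ _]].
  rewrite negb_or => /andP[kx ks2].
  have jx : last x s2 \in x :: s2 by exact: mem_last.
  split => //.
    by apply/eqP => lk; move: jx; rewrite lk inE (negbTE kx) (negbTE ks2).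
  by apply/eqP => il; move: jx; rewrite -il inE (negbTE ix) (negbTE is2).
have noncollider l a b c r : i :: s = l ++ [:: a, b, c & r] ->
    ~~ (arc H a b && arc H c b).
  by move=> /(active_trailP _ _ _ _ act); rewrite unblocked0.
apply: v_lt => //.
  apply/(tree_d_separatedP _ Etree HE ps us); apply/active_trailP => act_k.
  have [l [a lE]] : exists l a, i :: s1 = rcons l a.
    by exists (belast i s1), (last i s1); exact: lastI.
  have tE : i :: s = l ++ [:: a, k, x & s2].
    by rewrite /s -cat_cons lE cat_rcons.
  have := act_k _ _ _ _ _ tE.
  by rewrite unblocked_noncollider ?(noncollider _ _ _ _ _ tE)// finset.set11.
move: (ps) (us); rewrite /s cat_path -cat_cons cat_uniq.
move=> /andP[_] /= /andP[_ pk] /and3P[_ _ uk].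
have := @tree_d_separatedP p E H [set i]%SET k (x :: s2) Etree HE pk uk.
rewrite /= -sE => -> /negP; apply; apply/(active_trailP H [set i]%SET k (x :: s2)).
move=> l a b c r tE; have tE' : i :: s = (i :: s1 ++ l) ++ [:: a, b, c & r].
  by rewrite /s tE /= catA.
rewrite unblocked_noncollider ?(noncollider _ _ _ _ _ tE')//.
rewrite finset.in_set1; apply/eqP => bi; move: us; rewrite tE' /= bi.
by rewrite !mem_cat !inE eqxx !orbT.
Qed.

(** If the path has a collider, its ends carry no information on each other. Otherwise it is
    shortened to the edge ab from either end; as the ends are not adjacent, at least one shortening
    is proper, hence strict. *)
Lemma tree_information_lt i s l a b r : path (adj E) i s -> uniq (i :: s) ->
  i :: s = l ++ [:: a, b & r] -> ~~ adj E i (last i s) ->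
  v i (last i s) < v a b.
Proof.
move=> ps us sE nadj; set j := last i s.
have ab_adj : adj E a b.
  case: l sE => [|i' l] /= [iE sE]; move: ps; rewrite sE iE /=.
    by case/andP.
  by rewrite cat_path /= => /and3P[_ _ /andP[]].
have ab : a != b by case/andP: ab_adj.
have [act|nact] := boolP (active_trail H finset.set0 i s); last first.
  have ij : i != j := uniq_last_neq us sE.
  rewrite v_eq0//; last exact/(tree_d_separatedP _ Etree HE ps us).
  apply: v_gt0 => // /(tree_d_separatedP (s := [:: b]) _ Etree HE).
  by rewrite /= andbT ab_adj inE ab => /(_ isT isT).
have jE : j = last b r by rewrite /j -(last_cons i) sE last_cat.
have [pa ua] : path (adj E) a (b :: r) /\ uniq [:: a, b & r].
  case: l sE => [|i' l] /= [iE sE]; first by move: ps us; rewrite sE iE.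
  move: ps us; rewrite sE iE /= cat_path cat_uniq /= => /and3P[_ _ pb].
  by move=> /and4P[_ _ _ ub].
have le1 : (l = [::] /\ i = a) \/ v i j < v a j.
  case: l sE => [|i' l] /= [iE sE]; [by left|right].
  by rewrite /j sE; apply: active_lt; rewrite -sE.
have le2 : (r = [::] /\ j = b) \/ v a j < v a b.
  have [r0|[r' rE]] : r = [::] \/ exists r', r = rcons r' j.
  - case: r jE {sE pa ua} => [|x r] jE; [by left|right].
    by exists (belast x r); rewrite jE /= -lastI.
  - by left; rewrite jE r0.
  (* [active_lt] only moves the first vertex of a path, so the other end is moved along the reversed
     path. *)
  right; pose t := rev r' ++ [:: b; a].
  have tE : j :: t = rev [:: a, b & r].
    by rewrite rE !rev_cons rev_rcons /t -!cats1 /= -catA.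
  have aj : a != j.
    by move: ua; rewrite rE /= inE negb_or mem_rcons inE negb_or => /andP[/and3P[]].
  have pt : path (adj E) j t.
    have := rev_path (adj E) a (b :: r); rewrite rE /= last_rcons belast_rcons.
    rewrite !rev_cons -!cats1 -catA => ->.
    have symE : (fun z => (adj E)^~ z) =2 adj E by move=> x y; rewrite adj_sym.
    by rewrite /= adj_sym (eq_path symE) cats1 -rE; exact: pa.
  have ut : uniq (j :: t) by rewrite tE rev_uniq.
  have lt : last j t = a by rewrite /t last_cat.
  have at' : active_trail H finset.set0 j t.
    apply/active_trailP => l' u' w' x' r0 /(congr1 rev).
    rewrite tE revK rev_cat !rev_cons -!cats1 -!catA /= => abE.
    have := active_trailP _ _ _ _ act (l ++ rev r0) x' w' u' (rev l').
    by rewrite sE abE catA unblocked_sym; exact.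
  have := active_lt pt ut at'; rewrite lt v_sym 1?eq_sym//.
  by rewrite (v_sym (i := b)) 1?eq_sym.
case: le1 => [[l0 ia]|lt1]; case: le2 => [[r0 jb]|lt2].
- by case/negP: nadj; rewrite -/j ia jb.
- by rewrite ia.
- by rewrite -jb.
- exact: lt_trans lt2.
Qed.

End tree_information.

(** * The maximum weight spanning tree *)

Section spanning_tree.
Context (R : realType) (p : nat) (I : 'I_p -> 'I_p -> R).
Implicit Types E : {set {set 'I_p}}.

(* The algorithm only reads [I i j] for [i < j]. *)
Definition sym_information (i j : 'I_p) : R := if (i < j)%N then I i j else I j i.

Lemma sym_informationC i j : i != j -> sym_information i j = sym_information j i.
Proof. by rewrite /sym_information -val_eqE /=; case: ltngtP. Qed.

Lemma tree_weight_add E E' a b : a != b -> ~~ adj E a b ->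
  (forall x y, adj E' x y =
     adj E x y || ((x == a) && (y == b) || (x == b) && (y == a))) ->
  tree_weight I E' = tree_weight I E - sym_information a b.
Proof.
wlog ab : a b / (a < b)%N => [hwlog anb nab E'E|anb nab E'E].
  have [ab|ba|ab] := ltngtP a b; first exact: hwlog.
  - rewrite sym_informationC//; apply: hwlog => //; first by rewrite eq_sym.
      by rewrite adj_sym.
    by move=> x y; rewrite E'E; congr (_ || _); rewrite orbC.
  - by move: anb; rewrite (val_inj ab) eqxx.
rewrite /tree_weight !pair_big_dep /=.
rewrite (bigD1 (a, b)) /=; last by rewrite ab E'E !eqxx orbT.
rewrite addrC /sym_information ab; congr (_ - _).
apply: eq_bigl => -[x y] /=; rewrite E'E xpair_eqE.
have [->|xa] := eqVneq x a; have [->|yb] := eqVneq y b => /=.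
- by rewrite andbF (negbTE nab) !andbF.
- by rewrite (negbTE anb) /= orbF andbT.
- by rewrite (eq_sym b) (negbTE anb) andbF orbF andbT.
- rewrite andbT; have [xb|_] := eqVneq x b; have [ya|_] := eqVneq y a => /=;
  rewrite ?orbF//.
  by rewrite xb ya [(b < a)%N]ltnNge (ltnW ab).
Qed.

Lemma tree_sub_eq E T : is_tree E -> is_tree T ->
  (forall x y, adj E x y -> adj T x y) -> E = T.
Proof.
move=> Etree Ttree ET.
have adjE x y : adj E x y = adj T x y.
  apply/idP/idP => [/ET//|xyT]; apply/negPn/negP => nxy.
  have := tree_bridge Ttree xyT => /negP; apply.
  have [_ /(_ x y) c _] := Etree; apply: connect_sub c => u v uv; apply: connect1.
  rewrite adj_delE ET//=; apply/negP => /orP[]/andP[/eqP ux /eqP vy];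
    by move: uv nxy; rewrite ux vy ?(adj_sym _ y) => ->.
have card2 (F : {set {set 'I_p}}) e :
  is_tree F -> e \in F -> exists x y, e = [set x; y]%SET /\ x != y.
  by move=> [/(_ e) c _ _] /c /eqP/cards2P[x [y [xy ->]]]; exists x, y.
apply/setP => e; apply/idP/idP => eF.
- have [x [y [eE xy]]] := card2 E e Etree eF.
  have : adj T x y by rewrite -adjE /adj /= xy -eE.
  by case/andP => _; rewrite -eE.
- have [x [y [eE xy]]] := card2 T e Ttree eF.
  have : adj E x y by rewrite adjE /adj /= xy -eE.
  by case/andP => _; rewrite -eE.
Qed.

(** The edge uv joins the two components of [E0]. A detour around an old edge contradicts its being
    a bridge of [E] if it avoids uv, and connects [u] and [v] within [E0] if it uses uv. *)
Lemma tree_exchange E i j u v (E0 := E :\ [set i; j]%SET) : is_tree E ->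
  adj E i j -> connect (adj E0) i u -> ~~ connect (adj E0) i v ->
  is_tree ([set u; v]%SET |: E0) /\
  (forall x y, adj ([set u; v]%SET |: E0) x y =
     adj E0 x y || ((x == u) && (y == v) || (x == v) && (y == u))).
Proof.
move=> Etree ij iu niv.
have uv : u != v by apply: contra niv => /eqP <-.
have adjE' x y : adj ([set u; v]%SET |: E0) x y =
     adj E0 x y || ((x == u) && (y == v) || (x == v) && (y == u)).
  rewrite {1}/adj /= finset.in_setU1 andb_orr orbC; congr (_ || _).
  apply/andP/orP => [[xy /eqP/eq_set2[] [-> ->]]|].
  - by left; rewrite !eqxx.
  - by right; rewrite !eqxx.
  - case=> /andP[/eqP -> /eqP ->]; first by rewrite uv eqxx.
    by rewrite eq_sym uv finset.setUC eqxx.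
have conn0 z : connect (adj E0) i z \/ connect (adj E0) j z.
  have [_ /(_ i z) c _] := Etree.
  have : connect [rel a b | [|| adj E0 a b, (a == i) && (b == j) |
      (a == j) && (b == i)]] i z.
    apply: connect_sub c => a b ab; apply: connect1.
    by rewrite /= adj_delE ab /= orNb.
  by case/connect_add_edge => [|[]|[_]]; [left|right|left].
split => //.
have e0sub : subrel (adj E0) (connect (adj ([set u; v]%SET |: E0))).
  by move=> x y xy; apply: connect1; rewrite adjE' xy.
have e0conn x y : connect (adj E0) x y -> connect (adj ([set u; v]%SET |: E0)) x y.
  exact: connect_sub.
apply: bridges_tree.
- move=> e; rewrite finset.in_setU1 => /orP[/eqP ->|]; first by rewrite cards2 uv.
  by rewrite finset.in_setD1 => /andP[_]; case: Etree => + _ _; exact.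
- have conni z : connect (adj ([set u; v]%SET |: E0)) i z.
    have [/e0conn//|/e0conn jz] := conn0 z.
    have [iv|jv] := conn0 v; first by rewrite iv in niv.
    apply: (connect_trans (e0conn _ _ iu)); apply: (@connect_trans _ _ v).
      by apply: connect1; rewrite adjE' !eqxx orbT.
    apply: connect_trans jz.
    by rewrite connect_adj_sym; exact: e0conn.
  by move=> x y; apply: connect_trans (conni y); rewrite connect_adj_sym.
- move=> x y; rewrite adjE' => xyE'; apply/negP => cxy.
  have [xyuv|xyuv] := boolP ((x == u) && (y == v) || (x == v) && (y == u)).
    have cuv : connect (adj E0) u v.
      have : connect (adj E0) x y.
        apply: connect_sub cxy => a b; rewrite adj_delE adjE' => /andP[abE' abxy].
        apply: connect1; case/orP: abE' => // abuv; case/negP: abxy.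
        move: xyuv abuv => /orP[] /andP[/eqP -> /eqP ->] /orP[] /andP[/eqP ->
          /eqP ->];
          by rewrite !eqxx ?orbT.
      by case/orP: xyuv => /andP[/eqP -> /eqP ->]//; rewrite connect_adj_sym.
    by case/negP: niv; exact: connect_trans cuv.
  move: xyE'; rewrite (negbTE xyuv) orbF => xy0.
  have xyE := adj_del_sub xy0.
  pose E1 := E0 :\ [set x; y]%SET.
  have E1E a b : connect (adj E1) a b -> connect (adj E0) a b.
    by apply: connect_sub => c d /adj_del_sub cd; exact: connect1.
  have yx0 : connect (adj E0) y x by apply: connect1; rewrite adj_sym.
  have nuv : ~~ connect (adj E0) u v.
    by apply: contra niv; exact: connect_trans.
  have : connect [rel a b | [|| adj E1 a b, (a == u) && (b == v) |
      (a == v) && (b == u)]] x y.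
    apply: connect_sub cxy => a b; rewrite adj_delE adjE' => /andP[abE' abxy].
    by apply: connect1; rewrite /= adj_delE abxy andbT.
  case/connect_add_edge => [c|[/E1E c1 /E1E c2]|[/E1E c1 /E1E c2]].
  - have := tree_bridge Etree xyE => /negP; apply.
    apply: connect_sub c => a b; rewrite !adj_delE -andbA => /and3P[ab _ abxy].
    by apply: connect1; rewrite adj_delE ab.
  - case/negP: nuv; rewrite connect_adj_sym; apply: (connect_trans c2).
    exact: connect_trans c1.
  - case/negP: nuv; apply: (connect_trans c2); exact: connect_trans c1.
Qed.

(** An edge ij of [E] outside [T] is exchanged for the edge by which the path of [T] from [i] to [j]
    leaves the component of [i] in [E] without ij. *)
Lemma min_spanning_treeP T : is_tree T ->
  (forall i s l a b r, path (adj T) i s -> uniq (i :: s) ->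
     i :: s = l ++ [:: a, b & r] -> ~~ adj T i (last i s) ->
     sym_information i (last i s) < sym_information a b) ->
  forall E, min_spanning_tree I E <-> E = T.
Proof.
move=> Ttree Tlt.
have minT E : min_spanning_tree I E -> E = T.
  move=> [Etree Emin]; apply: tree_sub_eq => // i j ij; apply/negPn/negP => nij.
  pose E0 := E :\ [set i; j]%SET.
  have ij' : i != j by case/andP: ij.
  have nc := tree_bridge Etree ij.
  have [_ /(_ i j) /connectP[s0 ps0 jE0] _] := Ttree.
  have [s [ps us jE]] : exists s, [/\ path (adj T) i s, uniq (i :: s) & j = last i s].
    by move: jE0; case/shortenP: ps0 => s ps us _ jE; exists s.
  have [|l [u [v [r [sE iu niv uv]]]]] :=
    @path_crossing _ _ (fun z => connect (adj E0) i z) _ _ ps (connect0 _ _).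
    by rewrite -jE.
  have [E'tree E'adj] := tree_exchange Etree ij iu niv.
  have := Emin _ E'tree; rewrite leNgt => /negP; apply.
  have uv' : u != v by apply: contra niv => /eqP <-.
  rewrite (tree_weight_add uv' _ E'adj); last first.
    by apply: contra niv => uv0; apply: connect_trans iu (connect1 uv0).
  rewrite (@tree_weight_add E0 E i j)//.
  - rewrite ltrD2l ltrN2 jE; apply: Tlt sE _ => //.
    by rewrite -jE.
  - by rewrite adj_delE !eqxx andbF.
  - move=> x y; rewrite adj_delE.
    case: (boolP ((x == i) && (y == j) || (x == j) && (y == i))) => [|_].
      rewrite orbT; move=> /orP[] /andP[/eqP -> /eqP ->]; rewrite ?ij//.
      by rewrite adj_sym ij.
    by rewrite andbT orbF.
move=> E; split => [/minT//|->].
(* Trees are finite in number, so some minimizer exists, and it can only be [T]. *)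
have TT : [pred F | `[< is_tree F >]] T by exact/asboolP.
have [E0 /asboolP E0tree E0min] := @arg_minP _ _ _ T [pred F | `[< is_tree F >]]
  (tree_weight I) TT.
suff : min_spanning_tree I E0 by move=> H; rewrite -(minT _ H).
by split => // F /asboolP; exact: E0min.
Qed.

End spanning_tree.

(** * Runs of the algorithm *)

Section loop.
Context (R : realType) (p : nat).
Variables (I : 'I_p -> 'I_p -> R) (sc : dag p -> R).
Variables (T : {set {set 'I_p}}) (H : dag p).
Hypotheses (Ttree : is_tree T) (HT : skeleton H = T).
Hypothesis mstT : forall E, min_spanning_tree I E <-> E = T.
Hypothesis sc_equiv : forall D A, markov_equiv D A -> sc D = sc A.
Hypothesis sc_decomp : exists s : 'I_p -> {set 'I_p} -> R,
  forall D, sc D = \sum_(i < p) s i (parents D i).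
Hypothesis scH : forall D, skeleton D = T -> ~~ markov_equiv D H -> sc D < sc H.

Lemma eft_step_skeleton E D A : eft_step sc E D A -> skeleton A = skeleton D.
Proof. by case=> -[[S _ [_ [-> _ _ _]]] _] _. Qed.

Lemma best_candidate_exists E D G : eft_candidate E D G ->
  exists2 A, best_candidate sc E D A & sc G <= sc A.
Proof.
move=> DG; have DG' : [pred A | `[< eft_candidate E D A >]] G by exact/asboolP.
have [A /asboolP DA Amax] := @arg_maxP _ _ _ G [pred A | `[< eft_candidate E D A
  >]] sc DG'.
by exists A; [split => // F /asboolP; exact: Amax|exact: Amax].
Qed.

Lemma eft_stop_optimal D : skeleton D = T -> eft_stop sc T D -> markov_equiv D H.
Proof.
move=> DT stop; apply/negPn/negP => nDH.
have [G DG lt_DG] := improving_candidate Ttree sc_equiv sc_decomp DT HT (scH DT nDH).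
have [A DA le_GA] := best_candidate_exists DG.
by have := stop A DA; rewrite leNgt (lt_le_trans lt_DG le_GA).
Qed.

Lemma eft_loop_optimal E D out : E = T -> eft_loop sc E D out -> skeleton D = T ->
  markov_equiv out H.
Proof.
move=> ET; elim=> [A stop AT|A B ? AB _ IH AT].
  by apply: eft_stop_optimal => //; rewrite -ET.
by apply: IH; rewrite (eft_step_skeleton AB).
Qed.

(** Every step leaves fewer DAGs of higher score. *)
Lemma eft_step_Acc E D : Acc (fun B A => eft_step sc E A B) D.
Proof.
pose better B := #|[pred A | sc B < sc A]|.
have [n] := ubnP (better D); elim: n D => [|n IHn] D; first by rewrite ltn0.
rewrite ltnS => le_n; constructor => A [_ DA]; apply: IHn; apply: leq_trans le_n.
rewrite /better; apply: proper_card; apply/properP; split.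
  by apply/fintype.subsetP => B; rewrite !inE; exact: lt_trans.
by exists A; rewrite !inE// ltxx.
Qed.

Lemma eft_loop_exists E D : exists out, eft_loop sc E D out.
Proof.
elim: (eft_step_Acc E D) => {}D _ IH.
have [[A DA]|none] := pselect (exists A, eft_step sc E D A).
  by have [out Aout] := IH A DA; exists out; exact: EftStep DA Aout.
exists D; constructor => A DA; rewrite leNgt; apply/negP => lt_DA.
by apply: none; exists A.
Qed.

Lemma eft_returns_optimal : eft_returns I sc (fun out => markov_equiv out H).
Proof.
split.
- have [out Ho] := eft_loop_exists T H; exists out, T, H; split => //.
  by split => //; exact/mstT.
- by move=> E D _; exact: eft_step_Acc.
- move=> out [E [D [[/mstT ET DE] loop]]].
  by apply: (eft_loop_optimal ET loop); rewrite DE.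
Qed.

End loop.

(** * Large samples *)

Section with_high_probability.
Context (R : realType) (d : measure_display) (Omega : measurableType d)
  (Q : probability Omega R).

Lemma whp_sub (E F : nat -> set Omega) : (forall n, E n `<=` F n) ->
  whp Q E -> whp Q F.
Proof.
move=> EF [A [AE A1]]; exists A; split => // n; have [mA An] := AE n.
by split => // w /An; exact: EF.
Qed.

Lemma whp_true (E : nat -> set Omega) : (forall n w, E n w) -> whp Q E.
Proof.
move=> ET; exists (fun=> setT); split; first by move=> n; split => // w _.
by rewrite probability_setT; exact: cvg_cst.
Qed.

Lemma whp_and (E F : nat -> set Omega) : whp Q E -> whp Q F ->
  whp Q (fun n => E n `&` F n).
Proof.
move=> [A [AE A1]] [B [BF B1]]; exists (fun n => A n `&` B n); split.
  move=> n; have [[mA An] [mB Bn]] := (AE n, BF n); split; first exact: measurableI.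
  exact: setISS.
(* The probability of the intersection is squeezed between this bound and 1. *)
have lower : (Q (A n) + Q (B n) - 1)%E @[n --> \oo] --> 1%E.
  rewrite -[X in _ --> X](_ : (1 + 1 - 1 = 1)%E); last by rewrite addeK.
  by apply: cvgeB => //; [apply: cvgeD|exact: cvg_cst].
apply: (squeeze_cvge _ lower (cvg_cst 1%E)); apply: nearW => n.
have [[mA _] [mB _]] := (AE n, BF n).
rewrite probability_le1 ?andbT; last exact: measurableI.
rewrite leeBlDr// (measureDI Q mA mB) addeAC addeC leeD2l//.
rewrite -measureU//; [|exact: measurableD|].
  by apply: probability_le1; apply: measurableU => //; exact: measurableD.
by rewrite setDE setIAC -setIA setICr setI0.
Qed.

Lemma whp_forall (K : finType) (E : K -> nat -> set Omega) :
  (forall k, whp Q (E k)) -> whp Q (fun n => [set w | forall k, E k n w]).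
Proof.
move=> EK; suff : whp Q (fun n => [set w | forall k, k \in enum K -> E k n w]).
  by apply: whp_sub => n w Ew k; apply: Ew; rewrite mem_enum.
elim: (enum K) => [|k s IHs]; first exact: whp_true.
apply: whp_sub (whp_and (EK k) IHs) => n w [Ekw Esw] k'.
by rewrite inE => /orP[/eqP ->|/Esw].
Qed.

End with_high_probability.

Lemma disjoint_singletons (p : nat) (i j k : 'I_p) : i != j -> i != k -> j != k ->
  disjoint3 [set i]%SET [set j]%SET [set k]%SET.
Proof. by move=> ij ik jk;
  rewrite /disjoint3 !disjoints1 !finset.in_set1 ij ik jk. Qed.

Lemma disjoint_singletons0 (p : nat) (i j : 'I_p) : i != j ->
  disjoint3 [set i]%SET [set j]%SET finset.set0.
Proof. by move=> ij; rewrite /disjoint3 !disjoints1 !finset.in_set0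
  finset.in_set1 ij. Qed.

Theorem proposition4p4 (R : realType) (p : nat)
  (* reference measures for the densities *)
  (mu : line_measures R p)
  (nu : {measure set (vec R p) -> \bar R}) (hnu : is_product_measure mu nu)
  (* the parametric DAG models and the properties of their BIC *)
  (M : dag_model R p) (hM : parametric_dag_model M nu)
  (hmle : mles_eventually_exist M nu)
  (hequiv : score_equivalent M) (hdec : decomposable M)
  (hcons : bic_consistent M nu)
  (* the estimator of mutual information *)
  (Ihat : forall n, data R p n -> 'I_p -> 'I_p -> R)
  (hI : mi_consistent M nu mu Ihat)
  (* the data-generating distribution *)
  (P : probability (vec R p) R) (hP : in_family M nu P)
  (hfin : forall i j : 'I_p, i != j -> exists v, is_mutual_info mu P i j v)
  (H : dag p) (htree : is_tree (skeleton H)) (hfaith : faithful P H)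
  (* the random sample *)
  (d : measure_display) (Omega : measurableType d) (Q : probability Omega R)
  (X : nat -> Omega -> vec R p) (hX : iid_sample P Q X) :
  whp Q (fun n => [set w |
    eft_returns (Ihat n (sample_data X n w)) (bic M (sample_data X n w))
      (fun out => markov_equiv out H)]).
Proof.
have /choice[v0 v0P] : forall ij : 'I_p * 'I_p, exists v, ij.1 != ij.2 ->
    is_mutual_info mu P ij.1 ij.2 v.
  move=> [i j]; have [->|ij] := eqVneq i j; first by exists 0.
  by have [v vP] := hfin i j ij; exists v.
pose v i j := sym_information (fun a b => v0 (a, b)) i j.
have vP i j : i != j -> is_mutual_info mu P i j (v i j).
  move=> ij; rewrite /v /sym_information; case: ifP => _; first exact: (v0P (i, j)).
  by apply: is_mutual_info_sym; apply: (v0P (j, i)); rewrite /= eq_sym.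
have PH : contains M nu H P.
  by apply/(hM.2 H P); split => // A B C dis sep; exact/(hfaith _ _ _ dis).
(* If the model of [D] contains P, then P is Markov to [D], and faithfulness turns the separations
   of [D] into separations of [H]. *)
have not_contains D : skeleton D = skeleton H -> ~~ markov_equiv D H ->
    ~ contains M nu D P.
  move=> DH /negP nDH /(hM.2 D P)[_ PD]; apply: nDH.
  apply: (d_separated_markov_equiv htree DH erefl) => A B C dis sep.
  by apply/(hfaith _ _ _ dis); exact: PD.
have score_whp : whp Q (fun n => [set w | forall D, skeleton D = skeleton H ->
    ~~ markov_equiv D H -> bic M (sample_data X n w) D < bic M (sample_data X n
      w) H]).
  apply: whp_forall => D.
  have [DH|DH] := eqVneq (skeleton D) (skeleton H); last first.
    by apply: whp_true => n w DH'; rewrite DH' eqxx in DH.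
  have [e|nDH] := boolP (markov_equiv D H); first by apply: whp_true.
  apply: whp_sub (hcons P d Omega Q X hX H D PH (or_introl (not_contains D DH nDH))).
  by move=> n w lt_DH _ _.
have est_whp i j eps : i != j -> 0 < eps -> whp Q (fun n => [set w |
    `|sym_information (Ihat n (sample_data X n w)) i j - v i j| < eps]).
  move=> ij eps0; rewrite /v /sym_information; case: ifP => _.
    exact: (hI P hP d Omega Q X hX i j (v0 (i, j)) ij (v0P (i, j) ij)).
  have ji : j != i by rewrite eq_sym.
  exact: (hI P hP d Omega Q X hX j i (v0 (j, i)) ji (v0P (j, i) ji)).
have info_whp : whp Q (fun n => [set w | forall q : ('I_p * 'I_p) * ('I_p * 'I_p),
    q.1.1 != q.1.2 -> q.2.1 != q.2.2 -> v q.1.1 q.1.2 < v q.2.1 q.2.2 ->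
    sym_information (Ihat n (sample_data X n w)) q.1.1 q.1.2 <
    sym_information (Ihat n (sample_data X n w)) q.2.1 q.2.2]).
  apply: whp_forall => -[[i j] [a b]] /=.
  have [ij|ij] := eqVneq i j; first by apply: whp_true.
  have [ab|ab] := eqVneq a b; first by apply: whp_true.
  have [vlt|vle] := ltP (v i j) (v a b); last by apply: whp_true.
  (* Errors below half the gap preserve the strict order of the two values. *)
  have eps0 : 0 < (v a b - v i j) / 2 by rewrite divr_gt0// subr_gt0.
  apply: whp_sub (whp_and (est_whp i j _ ij eps0) (est_whp a b _ ab eps0)).
  move=> n w [] /=; rewrite !ltr_norml => /andP[_ h1] /andP[h2 _] _ _ _; lra.
apply: whp_sub (whp_and (hmle P hP d Omega Q X hX) (whp_and score_whp info_whp)).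
move=> n w [/= mles [score_lt info_lt]].
apply: (eft_returns_optimal htree erefl) => //.
- apply: min_spanning_treeP => // i s l a b r ps us sE nadj.
  have ij := uniq_last_neq us sE.
  have ab : a != b.
    move: us; rewrite sE cat_uniq => /and3P[_ _] /=; rewrite inE negb_or.
    by move=> /andP[/andP[]].
  apply: (info_lt ((i, last i s), (a, b))) => //=.
  apply: (tree_information_lt htree erefl _ _ _ _ ps us sE nadj).
  + by move=> x y xy; exact: sym_informationC.
  + move=> x y z xy xz yz sep nsep.
    have [yx zx zy] : [/\ y != x, z != x & z != y].
      by split; rewrite eq_sym.
    apply: (mutual_info_lt (vP x y xy) (vP z y zy) (vP z x zx) (vP x z xz)).
      by apply/(hfaith _ _ _ (disjoint_singletons xy xz yz)).
    by move=> /(hfaith _ _ _ (disjoint_singletons zy zx yx)).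
  + move=> x y xy sep; apply: (mutual_info_indep (vP x y xy)).
    by apply/(hfaith _ _ _ (disjoint_singletons0 xy)).
  + move=> x y xy nsep; apply: (mutual_info_dep (vP x y xy)).
    by move=> /(hfaith _ _ _ (disjoint_singletons0 xy)).
- by move=> D A DA; exact: hequiv.
- have [s [_ sE]] := hdec; exists (s n (sample_data X n w)) => D; exact: sE.
Qed.
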